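(* Assume $\mu_l>0$. Assume $(\mathcal{R},\Phi_l,\varrho)\in C^1([0,\infty);X)$, continuous up to $t=0$, is a solution of the viscous linearized system stated in the context. Then $\Phi_l=\Phi_l(r,t)$ and $\mathcal{R}=\mathcal{R}(t)$ are independent of $\theta$ and $\varphi$ for all $t\ge0$.
   Context: Constants: liquid density $\rho_l>0$, liquid viscosity $\mu_l>0$, surface tension $\sigma>0$, thermal conductivity $\kappa\ge0$, $T_\infty>0$, specific gas constant $\mathscr{R}_g>0$, $c_v>0$, $\gamma=1+\mathscr{R}_g/c_v$, far-field pressure $p_{\infty,*}>0$. Fix a bubble mass $M>0$ and let $R_*>0$ be the unique positive root of $p_{\infty,*}R_*^3+2\sigma R_*^2-\frac{3\mathscr{R}_gT_\infty M}{4\pi}=0$; set $p_*=p_{\infty,*}+\frac{2\sigma}{R_*}$ and $\rho_*=\frac{p_*}{\mathscr{R}_gT_\infty}$. $B_1\subset\mathbb{R}^3$ is the unit ball; $(r,\theta,\varphi)$ are spherical coordinates for $y\in\mathbb{R}^3$ ($\theta$ polar, $\varphi$ azimuthal); $\Delta_S$ is the Laplace–Beltrami operator on $\mathbb{S}^2$. $Y_\ell^m:\mathbb{S}^2\to\mathbb{R}$, $\ell\ge0$, $|m|\le\ell$, are the $L^2(\mathbb{S}^2)$-orthonormal spherical harmonics, $Y_0^0=1/(2\sqrt\pi)$. Viscous linearized system ($\mu_l>0$) for $\mathcal{R}(\theta,\varphi,t)$ (surface displacement), $\Phi_l(y,t)$ (liquid velocity potential), $\varrho(y,t)$ (gas density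 perturbation), with associated $\mathcal{P}_l(y,t)$, $\mathcal{P}_g(t)$, $\Phi_g(y,t)$ (liquid pressure, spatially uniform gas pressure, gas velocity potential): In $\mathbb{R}^3\setminus B_1$, $t>0$: $\partial_t\Phi_l=-\frac{1}{\rho_lR_*}\mathcal{P}_l$, $\Delta_y\Phi_l=0$. In $B_1$, $t>0$: $\partial_t\varrho+\frac{\rho_*}{R_*}\Delta_y\Phi_g=0$, $\mathcal{P}_g=\mathcal{P}_g(t)$, $\partial_t\varrho=\frac{\kappa}{\gamma c_v}\frac{1}{\rho_*R_*^2}\Delta_y\varrho+\frac{\rho_*}{\gamma p_*}\partial_t\mathcal{P}_g$. On $\partial B_1$, $t>0$: $\partial_r\Phi_l=\partial_r\Phi_g=\partial_t\mathcal{R}$; $\;\mathcal{P}_g-\mathcal{P}_l+\frac{2\mu_l}{R_*^2}\partial_r^2\Phi_l=-\frac{\sigma}{R_*^2}(2+\Delta_S)\mathcal{R}$; $\;\partial_\theta\partial_r\Phi_l-\partial_\theta\Phi_l=0$; $\;\partial_\varphi\partial_r\Phi_l-\partial_\varphi\Phi_l=0$; $\;\mathcal{P}_g=\mathscr{R}_gT_\infty\varrho$. Far field: as $|y|\to\infty$, $\nabla\Phi_l(y,t)=O(|y|^{-2})$, $D^2\Phi_l(y,t)\to0$, $\mathcal{P}_l(y,t)\to0$. Centroid condition: $\langle\mathcal{R},Y_1^m\rangle_{L^2(\mathbb{S}^2)}=0$ for $m=-1,0,1$. Mass constraint on the initial data: $\int_{B_1}\varrho(y,0)\,dy+2\sqrt{\pi}\,\frac{\rho_*}{R_*}\langle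 Y_0^0,\mathcal{R}(\cdot,\cdot,0)\rangle_{L^2(\mathbb{S}^2)}=0$. Function space: $X$ is the set of triples $(\mathcal{R},\Phi_l,\varrho)$ with $\mathcal{R}\in L^2(\mathbb{S}^2)$; $\Phi_l\in L^2(\mathbb{R}^3\setminus B_1)$ satisfying $\Delta\Phi_l=0$ and the far-field decay above; and $\varrho\in L^2(B_1)$ satisfying the mass constraint $\int_{B_1}\varrho\,dy+2\sqrt\pi\frac{\rho_*}{R_*}\langle Y_0^0,\mathcal{R}\rangle_{L^2(\mathbb{S}^2)}=0$. Solutions are understood to be regular enough that the equations and boundary conditions hold classically. *)

(* Defs.v *)
From HB Require Import structures.
From mathcomp Require Import all_boot all_order all_algebra.
From mathcomp Require Import all_classical all_reals all_analysis.

Set Implicit Arguments.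
Unset Strict Implicit.
Unset Printing Implicit Defensive.

Import Order.TTheory GRing.Theory Num.Theory.
Import numFieldNormedType.Exports.

Local Open Scope classical_set_scope.
Local Open Scope ring_scope.

Section Euclidean_space.
Context {R : realType}.
Implicit Types (y w : 'rV[R]_3) (f Phi : 'rV[R]_3 -> R) (U : set 'rV[R]_3).

(* The library norm on 'rV[R]_3 is the sup norm. *)
Definition enorm y : R := Num.sqrt (\sum_(i < 3) y 0 i ^+ 2).

Definition ball1 : set 'rV[R]_3 := [set y | enorm y < 1].
Definition sphere1 : set 'rV[R]_3 := [set y | enorm y = 1].
Definition ext1 : set 'rV[R]_3 := [set y | 1 < enorm y].

Definition partial (i : 'I_3) f : 'rV[R]_3 -> R := 'D_(delta_mx 0 i) f.

Definition grad f y : 'rV[R]_3 := \row_i partial i f y.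

Definition laplacian f y : R := \sum_(i < 3) partial i (partial i f) y.

(* For open U. *)
Definition C1_on U f : Prop :=
  forall y, U y -> differentiable f y /\
    forall i, {for y, continuous (partial i f)}.

Definition C2_on U f : Prop := C1_on U f /\ forall i, C1_on U (partial i f).

(* C^k up to the boundary, for U = ball1 or U = ext1: f is continuous on the
   closed domain and the derivatives of order <= k, which are only computed
   inside U, have limits at all points of the unit sphere. *)
Definition has_trace U f : Prop :=
  forall w, sphere1 w -> cvg (f y @[y --> within U (nbhs w)]).

Definition C1_upto U f : Prop :=
  [/\ C1_on U f, {within U `|` sphere1, continuous f}
    & forall i, has_trace U (partial i f)].

Definition C2_upto U f : Prop :=
  [/\ C2_on U f, C1_upto U f
    & forall i j, has_trace U (partial i (partial j f))].

Definition vanishes_at_infinity f : Prop :=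
  forall e : R, 0 < e -> exists A : R, forall y, A < enorm y -> `|f y| < e.

Definition far_field_decay Phi : Prop :=
  (exists C A : R, forall y, A < enorm y ->
     enorm (grad Phi y) <= C * enorm y ^- 2) /\
  (forall i j, vanishes_at_infinity (partial i (partial j Phi))).

End Euclidean_space.

Section Spherical_coordinates.
Context {R : realType}.
Implicit Types (f : 'rV[R]_3 -> R) (F : R -> R -> R -> R) (r th ph : R).

Definition mk3 (a b c : R) : 'rV[R]_3 :=
  \row_(i < 3) [:: a; b; c]`_i.

Definition sph r th ph : 'rV[R]_3 :=
  mk3 (r * sin th * cos ph) (r * sin th * sin ph) (r * cos th).

Definition in_sph f : R -> R -> R -> R := fun r th ph => f (sph r th ph).

Definition d_r F : R -> R -> R -> R :=
  fun r th ph => derive1 (fun s => F s th ph) r.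
Definition d_th F : R -> R -> R -> R :=
  fun r th ph => derive1 (fun s => F r s ph) th.
Definition d_ph F : R -> R -> R -> R :=
  fun r th ph => derive1 (fun s => F r th s) ph.

(* Values at r = 1, taken from outside and from inside the unit ball. *)
Definition bv_ext F th ph : R := lim (F r th ph @[r --> 1^'+]).
Definition bv_int F th ph : R := lim (F r th ph @[r --> 1^'-]).

(* A function on the unit sphere is represented by a function on 'rV[R]_3 of
   which only the values on sphere1 are used. *)
Definition C2_sphere f : Prop :=
  C2_on [set y | y != 0] (fun y => f ((enorm y)^-1 *: y)).

(* Meaningful for 0 < th < pi only: the chart is singular at the poles. *)
Definition laplace_beltrami f th ph : R :=
  (sin th)^-1 *
    derive1 (fun s => sin s * derive1 (fun s' => f (sph 1 s' ph)) s) th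
  + (sin th) ^- 2 * derive1n 2 (fun s => f (sph 1 th s)) ph.

(* Real spherical harmonics, without the Condon-Shortley sign; (sin th)^k is
   (1 - x^2)^(k/2) at x = cos th. *)
Definition legendre (l : nat) : {poly R} :=
  ((2 ^ l * l`!)%:R)^-1 *: derivn l (('X^2 - 1) ^+ l).

Definition sphY (l : nat) (m : int) th ph : R :=
  let k := absz m in
  let N := Num.sqrt ((2 * l + 1)%:R / (4 * pi)
                     * ((l - k)`!%:R / (l + k)`!%:R)) in
  N * (sin th ^+ k * (derivn k (legendre l)).[cos th])
  * match m with
    | Posz 0 => 1
    | Posz _ => Num.sqrt 2 * cos (k%:R * ph)
    | Negz _ => Num.sqrt 2 * sin (k%:R * ph)
    end.

End Spherical_coordinates.

Section Integrals.
Context {R : realType}.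
Implicit Types (D : set 'rV[R]_3) (f : 'rV[R]_3 -> R) (g : R -> R -> R).

Let leb := @lebesgue_measure R.

(* Lebesgue measure of R^3, carried by the measurable type R * R * R. *)
Definition leb3 := ((leb \x leb) \x leb)%E.

Definition of3 (z : R * R * R) : 'rV[R]_3 := mk3 z.1.1 z.1.2 z.2.

Definition sqnorm_L2 D f : \bar R :=
  (\int[leb3]_(z in of3 @^-1` D) ((f (of3 z)) ^+ 2)%:E)%E.

Definition in_L2 D f : Prop :=
  @measurable_fun _ _
    (measurableTypeR R * measurableTypeR R * measurableTypeR R)%type R
    (of3 @^-1` D) (fun z => f (of3 z))
  /\ (sqnorm_L2 D f < +oo)%E.

Definition integral_on D f : R :=
  Rintegral leb3 (of3 @^-1` D) (fun z => f (of3 z)).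

(* The surface measure of the unit sphere is sin th dth dph. *)
Definition angles : set (R * R) := `[0, pi] `*` `[0, 2 * pi].

Definition sqnorm_L2S f : \bar R :=
  (\int[leb \x leb]_(z in angles)
     ((f (sph 1 z.1 z.2)) ^+ 2 * sin z.1)%:E)%E.

Definition in_L2S f : Prop :=
  @measurable_fun _ _ (measurableTypeR R * measurableTypeR R)%type R
    angles (fun z => f (sph 1 z.1 z.2))
  /\ (sqnorm_L2S f < +oo)%E.

Definition inner_L2S f g : R :=
  Rintegral (leb \x leb)%E angles
    (fun z => f (sph 1 z.1 z.2) * g z.1 z.2 * sin z.1).

End Integrals.

Section Bubble.
Context {R : realType}.

Record params := Params {
  rho_l : R; mu_l : R; sigma : R; kappa : R; T_inf : R; R_g : R; c_v : R;
  p_inf : R; mass : R; R_star : R }.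

Implicit Type c : params.

Definition gamma c := 1 + R_g c / c_v c.
Definition p_star c := p_inf c + 2 * sigma c / R_star c.
Definition rho_star c := p_star c / (R_g c * T_inf c).

(* The cubic has exactly one positive root. *)
Record admissible c : Prop := {
  adm_rho_l : 0 < rho_l c;
  adm_sigma : 0 < sigma c;
  adm_kappa : 0 <= kappa c;
  adm_T_inf : 0 < T_inf c;
  adm_R_g : 0 < R_g c;
  adm_c_v : 0 < c_v c;
  adm_p_inf : 0 < p_inf c;
  adm_mass : 0 < mass c;
  adm_R_star : 0 < R_star c;
  adm_root : p_inf c * R_star c ^+ 3 + 2 * sigma c * R_star c ^+ 2
             - 3 * R_g c * T_inf c * mass c / (4 * pi) = 0 }.

Record state := State {
  disp : 'rV[R]_3 -> R;
  liq : 'rV[R]_3 -> R;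
  gas : 'rV[R]_3 -> R }.

Implicit Types (u v : state) (U : R -> state).

Definition mass_constraint c u : Prop :=
  integral_on ball1 (gas u)
  + 2 * Num.sqrt pi * (rho_star c / R_star c)
    * inner_L2S (disp u) (sphY 0 0) = 0.

Record in_X c u : Prop := {
  X_disp : in_L2S (disp u);
  X_liq : in_L2 (ext1 `|` sphere1) (liq u);
  X_liq_C2 : C2_on ext1 (liq u);
  X_liq_harmonic : forall y, ext1 y -> laplacian (liq u) y = 0;
  X_liq_decay : far_field_decay (liq u);
  X_gas : in_L2 ball1 (gas u);
  X_mass : mass_constraint c u }.

Definition sqnorm_X u : \bar R :=
  (sqnorm_L2S (disp u) + sqnorm_L2 (ext1 `|` sphere1) (liq u)
   + sqnorm_L2 ball1 (gas u))%E.

Definition sub_state u v : state :=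
  State (disp u \- disp v) (liq u \- liq v) (gas u \- gas v).

Definition scale_state (a : R) u : state :=
  State (fun y => a * disp u y) (fun y => a * liq u y) (fun y => a * gas u y).

(* U is in C^1([0, oo); X): dU is the derivative of U for the norm of X. *)
Definition C1_curve_X c U : Prop :=
  (forall t, 0 <= t -> in_X c (U t)) /\
  exists dU : R -> state,
    [/\ forall t, 0 <= t -> in_X c (dU t),
        forall t, 0 <= t ->
          sqnorm_X (sub_state (scale_state h^-1 (sub_state (U (t + h)) (U t)))
                              (dU t))
            @[h --> within [set h | 0 <= t + h] 0^'] --> 0%E
      & forall t, 0 <= t ->
          sqnorm_X (sub_state (dU s) (dU t))
            @[s --> within [set s | 0 <= s] (nbhs t)] --> 0%E].

Implicit Types (calR Phil varrho Pl Phig : 'rV[R]_3 -> R -> R) (Pg : R -> R).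

Definition snapshot calR Phil varrho (t : R) : state :=
  State (calR ^~ t) (Phil ^~ t) (varrho ^~ t).

Definition continuous_up_to_0 (D : set 'rV[R]_3) (f : 'rV[R]_3 -> R -> R) :=
  {within [set z : 'rV[R]_3 * R | D z.1 /\ 0 <= z.2],
    continuous (fun z : 'rV[R]_3 * R => f z.1 z.2)}.

(* The regularity that makes the system below meaningful pointwise. *)
Record classical_regularity calR Phil varrho Pl Phig Pg : Prop := {
  reg_calR0 : continuous_up_to_0 sphere1 calR;
  reg_Phil0 : continuous_up_to_0 (ext1 `|` sphere1) Phil;
  reg_varrho0 : continuous_up_to_0 (ball1 `|` sphere1) varrho;
  reg_calR : forall t, 0 < t -> C2_sphere (calR ^~ t);
  reg_calRt : forall t w, 0 < t -> sphere1 w -> derivable (calR w) t 1;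
  reg_Phil : forall t, 0 < t -> C2_upto ext1 (Phil ^~ t);
  reg_Philt : forall t y, 0 < t -> ext1 y -> derivable (Phil y) t 1;
  reg_Pl : forall t, 0 < t ->
    {within ext1 `|` sphere1, continuous (Pl ^~ t)};
  reg_varrho : forall t, 0 < t -> C2_on ball1 (varrho ^~ t);
  reg_varrhot : forall t y, 0 < t -> ball1 y -> derivable (varrho y) t 1;
  reg_Phig : forall t, 0 < t ->
    C2_on ball1 (Phig ^~ t) /\ C1_upto ball1 (Phig ^~ t);
  reg_Pg : forall t, 0 < t -> derivable Pg t 1 }.

Record viscous_system c calR Phil varrho Pl Phig Pg : Prop := {
  sys_bernoulli : forall t y, 0 < t -> ext1 y ->
    derive1 (Phil y) t = - (rho_l c * R_star c)^-1 * Pl y t;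
  sys_liq_harmonic : forall t y, 0 < t -> ext1 y ->
    laplacian (Phil ^~ t) y = 0;
  sys_gas_mass : forall t y, 0 < t -> ball1 y ->
    derive1 (varrho y) t
    + rho_star c / R_star c * laplacian (Phig ^~ t) y = 0;
  sys_gas_heat : forall t y, 0 < t -> ball1 y ->
    derive1 (varrho y) t
    = kappa c / (gamma c * c_v c) * (rho_star c * R_star c ^+ 2)^-1
        * laplacian (varrho ^~ t) y
      + rho_star c / (gamma c * p_star c) * derive1 Pg t;
  sys_kinematic_liq : forall t th ph, 0 < t -> 0 <= th <= pi ->
    bv_ext (d_r (in_sph (Phil ^~ t))) th ph = derive1 (calR (sph 1 th ph)) t;
  sys_kinematic_gas : forall t th ph, 0 < t -> 0 <= th <= pi ->
    bv_int (d_r (in_sph (Phig ^~ t))) th ph = derive1 (calR (sph 1 th ph)) t;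
  sys_normal_stress : forall t th ph, 0 < t -> 0 < th < pi ->
    Pg t - Pl (sph 1 th ph) t
    + 2 * mu_l c / R_star c ^+ 2
      * bv_ext (d_r (d_r (in_sph (Phil ^~ t)))) th ph
    = - (sigma c / R_star c ^+ 2)
      * (2 * calR (sph 1 th ph) t + laplace_beltrami (calR ^~ t) th ph);
  sys_tangential_th : forall t th ph, 0 < t -> 0 <= th <= pi ->
    bv_ext (d_th (d_r (in_sph (Phil ^~ t)))) th ph
    - bv_ext (d_th (in_sph (Phil ^~ t))) th ph = 0;
  sys_tangential_ph : forall t th ph, 0 < t -> 0 <= th <= pi ->
    bv_ext (d_ph (d_r (in_sph (Phil ^~ t)))) th ph
    - bv_ext (d_ph (in_sph (Phil ^~ t))) th ph = 0;
  sys_gas_law : forall t w, 0 < t -> sphere1 w ->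
    Pg t = R_g c * T_inf c * varrho w t;
  sys_far_field : forall t, 0 < t ->
    far_field_decay (Phil ^~ t) /\ vanishes_at_infinity (Pl ^~ t);
  sys_centroid : forall t (m : int), 0 <= t -> m \in [:: -1; 0; 1] ->
    inner_L2S (calR ^~ t) (sphY 1 m) = 0;
  sys_mass : mass_constraint c (snapshot calR Phil varrho 0) }.

End Bubble.

Arguments params R : clear implicits.
Arguments state R : clear implicits.

(* Main.v *)
Require Import Defs.
From mathcomp Require Import all_boot all_order all_algebra.
From mathcomp Require Import all_classical all_reals all_analysis.
From mathcomp Require Import ring lra.

Set Implicit Arguments.
Unset Strict Implicit.

Import Order.TTheory GRing.Theory Num.Theory.
Import numFieldNormedType.Exports.
Local Open Scope classical_set_scope.
Local Open Scope ring_scope.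

(** The symmetry is proved at every time [t > 0]; time [0] follows by
    continuity.

    The liquid. Put [psi y = y . grad Phi y - Phi y]. Because the spherical
    frame turns with the polar angle, the tangential condition in [th] says
    exactly that the derivative of [psi] along meridians tends to [0] at the
    unit sphere. The second derivatives of [Phi] have limits there, so this is
    uniform along each meridian, and all meridians meet at the north pole:
    [psi] has a constant trace, that is, [d_r Phi - Phi] is constant on the
    sphere. For an orthogonal matrix [Q] the function [Psi = Phi - Phi o Q] is
    then harmonic outside the ball, satisfies [d_r Psi = Psi] on the sphere,
    and tends to [0] at infinity, since a gradient of size [r ^- 2] produces an
    oscillation of size [r ^- 1] over the sphere of radius [r]. Such a function
    has no positive maximum: not inside, by harmonicity, and not on the sphere,
    where the Robin condition makes it increase outwards ([exterior_robin]).
    Hence [Phi <= Phi o Q] for every [Q], and since reflections exchange any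
    two points of equal norm, [Phi] is radial ([exterior_radial]).

    The surface. Bernoulli's equation now makes the liquid pressure constant on
    the sphere, and the normal stress balance becomes
    [2 calR + Delta_S calR = k] with [k] independent of the angles. The function
    [F y = |y| (calR (y / |y|) - k / 2)] is homogeneous of degree one and
    harmonic off the origin. Its second difference
    [F (y + h) + F (y - h) - 2 F y] is harmonic off three points, bounded near
    them, and tends to [0] at infinity because [F] is continuously
    differentiable and homogeneous; comparison with small multiples of the
    Newtonian potentials of the three points shows that it vanishes
    ([second_difference_le0]). So [F] is additive, hence linear
    ([degree1_harmonic_linear]), and [calR] is [k / 2] plus a linear form
    ([laplace_beltrami_eigen2]). The centroid conditions are a diagonal system
    in the coefficients of that form and annihilate it
    ([centroid_linear_eq0]). *)

(** * Euclidean norm and chain rules *)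

Section EuclideanNorm.
Context {R : realType}.
Implicit Types (y z : 'rV[R]_3).

Lemma sum3 (f : 'I_3 -> R) : \sum_(i < 3) f i = f 0 + f 1 + f 2%:R.
Proof.
rewrite !big_ord_recl big_ord0 addr0 addrA.
by congr (f _ + f _ + f _); apply/val_inj.
Qed.

Lemma sqr_enorm y : enorm y ^+ 2 = \sum_(i < 3) y 0 i ^+ 2.
Proof. by rewrite sqr_sqrtr// sumr_ge0// => i _; exact: sqr_ge0. Qed.

Lemma enorm_ge0 y : 0 <= enorm y.
Proof. exact: sqrtr_ge0. Qed.

Lemma coord_le_enorm y i : `|y 0 i| <= enorm y.
Proof.
rewrite -(@ler_pXn2r _ 2)// ?nnegrE ?normr_ge0 ?enorm_ge0// sqr_enorm.
rewrite real_normK ?num_real// (bigD1 i)//= lerDl sumr_ge0// => j _.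
exact: sqr_ge0.
Qed.

Lemma norm_le_enorm y : `|y| <= enorm y.
Proof.
rewrite [leLHS]mx_normrE; apply: bigmax_le; first exact: enorm_ge0.
by move=> [i j] _ /=; rewrite (ord1 i); exact: coord_le_enorm.
Qed.

Lemma coord_le_norm y i : `|y 0 i| <= `|y|.
Proof.
rewrite [leRHS]mx_normrE.
exact: (le_bigmax _ (fun ij : 'I_1 * 'I_3 => `|y ij.1 ij.2|) (0, i)).
Qed.

Lemma enorm_le_norm y : enorm y <= 2 * `|y|.
Proof.
have n0 : 0 <= `|y| by exact: normr_ge0.
rewrite -(@ler_pXn2r _ 2)// ?nnegrE ?enorm_ge0// ?mulr_ge0//.
have h i : y 0 i ^+ 2 <= `|y| ^+ 2.
  by rewrite -[y 0 i ^+ 2]real_normK ?num_real// ler_pXn2r ?nnegrE// coord_le_norm.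
rewrite sqr_enorm sum3.
have := h 0; have := h 1; have := h 2%:R; nra.
Qed.

Lemma enorm_eq0 y : (enorm y == 0) = (y == 0).
Proof.
apply/idP/idP => [/eqP y0|/eqP ->].
  by rewrite -normr_eq0 eq_le normr_ge0 -y0 norm_le_enorm.
by rewrite eq_le enorm_ge0 andbT (le_trans (enorm_le_norm 0))// normr0 mulr0.
Qed.

Lemma enorm_gt0 y : (0 < enorm y) = (y != 0).
Proof. by rewrite lt0r enorm_ge0 andbT enorm_eq0. Qed.

Lemma enormZ a y : enorm (a *: y) = `|a| * enorm y.
Proof.
rewrite /enorm -sqrtr_sqr -sqrtrM ?sqr_ge0// mulr_sumr; congr Num.sqrt.
by apply: eq_bigr => i _; rewrite !mxE exprMn.
Qed.

Lemma enorm_continuous : continuous (@enorm R).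
Proof.
have -> : @enorm R = Num.sqrt \o (fun z : 'rV[R]_3 =>
    z 0 0 ^+ 2 + z 0 1 ^+ 2 + z 0 2%:R ^+ 2).
  by apply/funext => z; rewrite /enorm sum3.
move=> y; apply: continuous_comp; last exact: sqrt_continuous.
have c i : {for y, continuous (fun z : 'rV[R]_3 => z 0 i ^+ 2)}.
  apply: (@continuous_comp _ _ _ (fun z : 'rV[R]_3 => z 0 i) (fun x : R => x ^+ 2)).
    exact: coord_continuous.
  exact: exprn_continuous.
by apply: (@continuousD _ R^o) => //; apply: (@continuousD _ R^o).
Qed.

Lemma normalize_enorm {y} : y != 0 -> enorm ((enorm y)^-1 *: y) = 1.
Proof.
move=> y0; rewrite enormZ ger0_norm ?invr_ge0 ?enorm_ge0// mulVf//.
by rewrite enorm_eq0.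
Qed.

Lemma closed_sphere1 : closed (@sphere1 R).
Proof.
apply: (@closed_comp _ _ (@enorm R) [set 1%R]); last exact: closed_eq.
by move=> y _; exact: enorm_continuous.
Qed.

Lemma bounded_enorm_le (D : set 'rV[R]_3) (A : R) :
  (forall y, D y -> `|y| <= A) -> bounded_set D.
Proof.
by move=> DA; exists A; split; [exact: num_real|move=> x Ax y Dy];
  exact: le_trans (DA y Dy) (ltW Ax).
Qed.

Lemma compact_sphere1 : compact (@sphere1 R).
Proof.
apply: bounded_closed_compact closed_sphere1.
by apply: (@bounded_enorm_le _ 1) => y <-; exact: norm_le_enorm.
Qed.

Lemma open_ext1 : open (@ext1 R).
Proof.
apply: (@open_comp _ _ (@enorm R) [set x | 1 < x]); last exact: open_gt.
by move=> y _; exact: enorm_continuous.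
Qed.

Lemma ext_closureE : (@ext1 R `|` @sphere1 R) = [set y | 1 <= enorm y].
Proof.
apply/seteqP; split => y /=; rewrite /ext1 /sphere1 /=.
  by case=> [/ltW//|->].
by rewrite le_eqVlt => /orP[/eqP <-|]; [right|left].
Qed.

Lemma closed_ext : closed (@ext1 R `|` @sphere1 R).
Proof.
rewrite ext_closureE; apply: (@closed_comp _ _ (@enorm R) [set x | 1 <= x]).
  by move=> y _; exact: enorm_continuous.
exact: closed_ge.
Qed.

End EuclideanNorm.

Section ChainRule.
Context {R : realType}.
Implicit Types (x y v w : 'rV[R]_3) (f g : 'rV[R]_3 -> R).

Lemma row_partial_basis v : v = \sum_(i < 3) v 0 i *: delta_mx 0 i.
Proof. by rewrite {1}[v]row_sum_delta. Qed.

Lemma derive_partial f x v : differentiable f x ->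
  'D_v f x = \sum_(i < 3) partial i f x * v 0 i.
Proof.
move=> df; rewrite deriveE// {1}(row_partial_basis v) linear_sum.
by apply: eq_bigr => i _; rewrite linearZ/= /partial deriveE// mulrC.
Qed.

(** Directional derivatives become derivatives of functions of one real variable,
    to which the one-dimensional rules apply. *)
Lemma is_derive_line f x v (d : R) :
  is_derive x v f d <-> is_derive (0 : R) 1 (fun h : R => f (h *: v + x)) d.
Proof.
have e : 'D_v f x = 'D_1 (fun h : R => f (h *: v + x)) 0.
  rewrite /derive.
  set g1 := fun h => h^-1 *: _; set g2 := fun h => h^-1 *: _.
  suff -> : g1 = g2 by [].
  by rewrite funeqE /g1 /g2 => h /=; rewrite addr0 scale0r add0r [_%:A]mulr1.
split=> -[df dE].
  by apply: DeriveDef; [rewrite -derivable1P|rewrite -e].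
by apply: DeriveDef; [rewrite derivable1P|rewrite e].
Qed.

(** Second derivatives along a curve are obtained by applying this twice, first
    to [f] and then to its partial derivatives. *)
Lemma is_derive_curve f (c : R -> 'rV[R]_3) (dc : 'rV[R]_3) (t : R) :
  differentiable f (c t) ->
  (forall i, is_derive t 1 (fun s => c s 0 i) (dc 0 i)) ->
  is_derive t 1 (fun s => f (c s)) (\sum_(i < 3) partial i f (c t) * dc 0 i).
Proof.
move=> df hc.
have dct : derivable c t 1.
  by apply/derivable_mxP => i j; rewrite (ord1 i); have [] := hc j.
have cdiff : differentiable c t by exact/derivable1_diffP.
have dcE : 'D_1 c t = dc.
  rewrite derive_mx//; apply/rowP => j; rewrite mxE.
  exact: (@derive_val _ _ _ _ _ _ _ (hc j)).
constructor; first by apply/derivable1_diffP; exact: differentiable_comp.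
rewrite deriveE; last exact: differentiable_comp.
rewrite (_ : (fun s => f (c s)) = f \o c)//.
rewrite diff_comp//= -[X in 'd f _ X]deriveE// dcE.
by rewrite -deriveE// derive_partial.
Qed.

Lemma is_derive_coord x v i : is_derive x v (fun y => y 0 i) (v 0 i).
Proof.
apply/is_derive_line.
have -> : (fun h : R => (h *: v + x) 0 i) = (fun h : R => h * v 0 i + x 0 i).
  by apply/funext => h; rewrite !mxE.
by apply: is_derive_eq; rewrite /GRing.scale/=; ring.
Qed.

Lemma enorm_differentiable y : y != 0 -> differentiable (@enorm R) y.
Proof.
move=> y0.
have -> : @enorm R = Num.sqrt \o (fun z : 'rV[R]_3 =>
    z 0 0 ^+ 2 + z 0 1 ^+ 2 + z 0 2%:R ^+ 2).
  by apply/funext => z; rewrite /enorm sum3.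
apply: differentiable_comp.
  have c i : differentiable (fun z : 'rV[R]_3 => z 0 i ^+ 2) y.
    have -> : (fun z : 'rV[R]_3 => z 0 i ^+ 2) = (fun z : 'rV[R]_3 => z 0 i) ^+ 2.
      exact/esym/exprfctE.
    exact/differentiableX/differentiable_coord.
  by apply: (@differentiableD _ _ R^o) => //; apply: (@differentiableD _ _ R^o).
apply/derivable1_diffP.
have p : 0 < y 0 0 ^+ 2 + y 0 1 ^+ 2 + y 0 2%:R ^+ 2.
  by rewrite -(sum3 (fun i => y 0 i ^+ 2)) -sqr_enorm exprn_gt0// enorm_gt0.
by case: (is_derive1_sqrt p).
Qed.

Lemma is_derive_enorm y i : y != 0 ->
  is_derive y (delta_mx 0 i) (@enorm R) (y 0 i / enorm y).
Proof.
move=> y0; apply/is_derive_line.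
pose q (h : R) := \sum_(j < 3) (h *: delta_mx 0 i + y) 0 j ^+ 2.
have q0 : q 0 = enorm y ^+ 2.
  by rewrite sqr_enorm /q; apply: eq_bigr => j _; rewrite scale0r add0r.
have dq : is_derive (0 : R) 1 q (2 * y 0 i).
  have -> : q = (fun h : R => enorm y ^+ 2 + 2 * y 0 i * h + h ^+ 2).
    apply/funext => h; rewrite /q sqr_enorm (bigD1 i)//= [in RHS](bigD1 i)//=.
    rewrite !mxE !eqxx/= mulr1.
    rewrite (eq_bigr (fun j => y 0 j ^+ 2)); first ring.
    by move=> j ji; rewrite !mxE (negPf ji) mulr0 add0r.
  by apply: is_derive_eq; rewrite /GRing.scale/=; ring.
have e : (fun h : R => enorm (h *: delta_mx 0 i + y)) = Num.sqrt \o q by [].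
rewrite e; have q0p : 0 < q 0 by rewrite q0 exprn_gt0// enorm_gt0.
apply: (@is_derive_eq _ _ _ _ _ _ _ _ (is_derive1_comp (is_derive1_sqrt q0p) dq)).
rewrite q0 sqrtr_sqr ger0_norm ?enorm_ge0//.
by field; rewrite enorm_eq0.
Qed.

End ChainRule.

(** * Maximum principle *)

Section Harmonic.
Context {R : realType}.
Implicit Types (x y v w : 'rV[R]_3) (f g u : 'rV[R]_3 -> R).

Lemma is_derive_continuous (f : R -> R) (t d : R) :
  is_derive t 1 f d -> {for t, continuous f}.
Proof.
by move=> [df _]; apply: differentiable_continuous; exact/derivable1_diffP.
Qed.

(** The version of [is_derive_line] at a parameter [s] other than [0]. *)
Lemma is_derive_lineS f x v (s d : R) : is_derive (s *: v + x) v f d ->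
  is_derive s 1 (fun h : R => f (h *: v + x)) d.
Proof.
move=> /is_derive_line df.
have -> : (fun h : R => f (h *: v + x)) =
    (fun h : R => f (h *: v + (s *: v + x))) \o (fun h : R => h - s).
  by apply/funext => h /=; rewrite addrA -scalerDl subrK.
have ds : is_derive s 1 (fun h : R => h - s) 1.
  by apply: is_derive_eq; rewrite ?subr0.
rewrite -[d]mulr1; apply: is_derive1_comp; rewrite subrr; exact: df.
Qed.

(** If [h] were positive, [g], which vanishes at the maximum, would be positive
    just to its right, and [p] would increase there. *)
Lemma second_derivative_test (p g : R -> R) (h : R) :
  (\forall s \near (0 : R), is_derive (s : R) 1 p (g s)) ->
  is_derive (0 : R) 1 g h -> (\forall s \near (0 : R), p s <= p 0) -> h <= 0.
Proof.
move=> dp dg pmax; rewrite leNgt; apply/negP => h0.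
have g0 : g 0 = 0.
  have /nbhs_ballP [e /= e0 he] : \forall s \near (0:R), is_derive (s : R) 1 p (g s) /\ p s <= p 0.
    by near do split.
  have b t : t \in `]- e, e[%R -> ball 0 e t.
    by rewrite in_itv/= /ball/= sub0r normrN ltr_norml.
  have z : (0 : R) \in `]- e, e[%R by rewrite in_itv/= oppr_lt0 e0.
  have d0 : is_derive (0:R) 1 p 0.
    apply: (@derive1_at_max _ p (- e) e 0); rewrite ?z//.
    - by rewrite ge0_cp// ltW.
    - by move=> t /b /he [[]].
    - by move=> t /b /he [].
  have [d1 _] := he _ (b _ z).
  by rewrite -(@derive_val _ _ _ _ _ _ _ d1) (@derive_val _ _ _ _ _ _ _ d0).
have gpos : \forall s \near 0^'+, 0 < g s.
  have := dg => -[dg1 dgE].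
  have q : g x / x @[x --> 0^'] --> h.
    move: (dg1); rewrite /derivable -dgE /derive => H.
    apply: cvg_trans H; apply: near_eq_cvg; near=> t.
    by rewrite /= addr0 g0 subr0 [_ *: 1]mulr1 mulrC.
  have H : \forall x \near 0^'+, 0 < g x / x.
    by apply: (cvgr_gt h) => //; exact: cvg_dnbhs_at_right q.
  near=> s.
  have s0 : 0 < s by near: s; exact: nbhs_right_gt.
  have : 0 < g s / s by near: s.
  by rewrite pmulr_lgt0 ?invr_gt0.
have [e /= e0 he] : \forall s \near (0:R), is_derive (s : R) 1 p (g s) /\ p s <= p 0.
  by near do split.
have gpos' : \forall s \near (0:R)^'+, forall c, 0 < c < s -> 0 < g c.
  move: gpos => -[r /= r0 hr]; near=> t.
  have tr : t < r by near: t; exact: nbhs_right_lt.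
  move=> x /andP[x0 xt]; apply: hr => //=.
  by rewrite sub0r normrN gtr0_norm// (lt_trans xt).
near (0:R)^'+ => s.
have s0 : 0 < s by near: s; exact: nbhs_right_gt.
have se : s < e by near: s; exact: nbhs_right_lt.
have he' (t : R) : 0 <= t <= s -> is_derive t 1 p (g t) /\ p t <= p 0.
  move=> /andP[t0 ts]; apply: he => /=.
  by rewrite sub0r normrN ger0_norm// (le_lt_trans ts).
have [||c] := @MVT _ p g 0 s s0.
- by move=> x; rewrite in_itv/= => /andP[/ltW x0 /ltW xs]; apply: (he' x _).1;
    rewrite x0.
- apply: derivable_within_continuous => x; rewrite in_itv/= => xs.
  by have [[]] := he' _ xs.
rewrite in_itv/= subr0 => /andP[c0 cs] ps.
have : p s <= p 0 by apply: (he' s _).2; rewrite lexx ltW.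
rewrite -subr_le0 ps leNgt => /negP; apply; rewrite mulr_gt0//.
suff : forall c, 0 < c < s -> 0 < g c by apply; rewrite c0.
by near: s.
Unshelve. all: by end_near. Qed.


(** Only pure second derivatives along the axes enter the maximum principle, and
    carrying them as explicit functions makes sums, multiples and translates
    immediate: no partial derivative has to be recomputed as a limit. *)
Definition harmonic_on (U : set 'rV[R]_3) u : Prop :=
  (forall y, U y -> {for y, continuous u}) /\
  exists g h : 'I_3 -> 'rV[R]_3 -> R, forall y, U y ->
    (forall i, is_derive y (delta_mx 0 i) u (g i y) /\
               is_derive y (delta_mx 0 i) (g i) (h i y)) /\
    \sum_(i < 3) h i y = 0.

Lemma near_line (U : set 'rV[R]_3) y v : nbhs y U ->
  \forall s \near (0 : R), U (s *: v + y).
Proof.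
move=> Uy; have c : {for 0 : R, continuous (fun s : R => s *: v + y)}.
  apply: continuousD; last exact: cst_continuous.
  exact: scalel_continuous.
by apply: c; rewrite scale0r add0r.
Qed.

(** The perturbation is strictly subharmonic, its Laplacian being [6 * e], whereas
    a local maximum has nonpositive second derivatives along the three axes. *)
Lemma harmonic_no_perturbed_max (U : set 'rV[R]_3) u y (e : R) :
  open U -> harmonic_on U u -> U y -> 0 < e ->
  ~ (\forall z \near y, u z + e * enorm z ^+ 2 <= u y + e * enorm y ^+ 2).
Proof.
move=> oU [_ [g [h gh]]] Uy e0 ymax.
suff H i : h i y + 2 * e <= 0.
  have := (gh y Uy).2; rewrite sum3; have := H 0; have := H 1; have := H 2%:R.
  by lra.
pose d : 'rV[R]_3 := delta_mx 0 i.
have sqE (s : R) : enorm (s *: d + y) ^+ 2 = enorm y ^+ 2 + 2 * y 0 i * s + s ^+ 2.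
  rewrite !sqr_enorm (bigD1 i)//= [in RHS](bigD1 i)//=.
  rewrite !mxE !eqxx/= mulr1.
  rewrite (eq_bigr (fun j => y 0 j ^+ 2)); first ring.
  by move=> j ji; rewrite !mxE (negPf ji) mulr0 add0r.
pose p (s : R) := u (s *: d + y) + e * (enorm y ^+ 2 + 2 * y 0 i * s + s ^+ 2).
pose q (s : R) := g i (s *: d + y) + e * (2 * y 0 i + 2 * s).
apply: (@second_derivative_test p q).
- have : \forall s \near (0 : R), U (s *: d + y).
    by apply: near_line; exact: open_nbhs_nbhs.
  apply: filterS => s /gh [/(_ i) [/is_derive_lineS du _] _].
  rewrite /p /q; apply: is_derive_eq; rewrite /GRing.scale/=; ring.
- have [/(_ i) [_ /is_derive_line dg] _] := gh y Uy.
  rewrite /q; apply: is_derive_eq; rewrite /GRing.scale/=; ring.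
- have := near_line d ymax; apply: filterS => s; rewrite sqE.
  by rewrite /p scale0r add0r mulr0 expr0n/= !addr0.
Qed.

(** The domain may be unbounded and the boundary condition is only required at
    positive boundary values, in the form that a small multiple of
    [enorm z ^+ 2] creates no local maximum there. The Robin problem outside the
    ball and the removable singularities of [second_difference_le0] are both of
    this form. *)
Lemma max_principle (D U : set 'rV[R]_3) u :
  closed D -> open U -> U `<=` D -> {within D, continuous u} ->
  harmonic_on U u ->
  (forall e : R, 0 < e -> exists A : R, forall y, D y -> A < `|y| -> u y < e) ->
  (forall w, D w -> ~ U w -> 0 < u w -> forall e : R, 0 < e ->
    ~ (\forall z \near w, D z ->
         u z + e * enorm z ^+ 2 <= u w + e * enorm w ^+ 2)) ->
  forall y, D y -> u y <= 0.
Proof.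
move=> cD oU UD uc uh uinf ubd y0 Dy0; rewrite leNgt; apply/negP => uy0.
pose e := u y0 / 2.
have e0 : 0 < e by rewrite divr_gt0.
have [A' hA'] := uinf e e0.
pose A := Num.max A' `|y0|.
have A0 : 0 <= A by rewrite le_max normr_ge0 orbT.
have hA y : D y -> A < `|y| -> u y < e.
  by rewrite gt_max => Dy /andP[? _]; exact: hA'.
pose K := D `&` [set y | `|y| <= A + 1].
have cK : compact K.
  apply: bounded_closed_compact; first by apply: (@bounded_enorm_le _ _ (A + 1)) => y [].
  apply: closedI => //; apply: (@closed_comp _ _ (fun y : 'rV[R]_3 => `|y|)
    [set x | x <= A + 1]); last exact: closed_le.
  by move=> y _; exact: norm_continuous.
have Ky0 : K y0.
  by split => //=; rewrite (@le_trans _ _ A)// ?lerDl// le_max lexx orbT.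
pose B := (2 * (A + 1)) ^+ 2.
have B0 : 0 < B by rewrite exprn_gt0// mulr_gt0// ltr_wpDl.
pose dl := e / B.
have dl0 : 0 < dl by rewrite divr_gt0.
pose v y := u y + dl * enorm y ^+ 2.
have vc : {within K, continuous v}.
  have c2 : {within K, continuous (fun y : 'rV[R]_3 => dl * enorm y ^+ 2)}.
    apply: continuous_subspaceT => z.
    apply: (@continuous_comp _ _ _ (@enorm R) (fun x : R => dl * x ^+ 2)).
      exact: enorm_continuous.
    apply: continuousM; first exact: cst_continuous.
    exact: exprn_continuous.
  have c1 : {within K, continuous u}.
    by apply: (continuous_subspaceW _ uc); exact: subIsetl.
  by move=> y; apply: cvgD; [exact: c1|exact: c2].
(* [dl] is so small that the perturbation stays below [e] on [K], so that the
   maximum of [v], at least [2 * e], is not attained on the outer rim of [K]. *)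
have [y1 + ymax] := @compact_EVT_max _ _ v K (ex_intro _ y0 Ky0) cK vc.
rewrite inE => -[Dy1 y1A].
have vy1 : 2 * e <= v y1.
  apply: le_trans (ymax y0 _); last by rewrite inE.
  have -> : 2 * e = u y0 by rewrite /e mulrC divfK.
  by rewrite /v lerDl mulr_ge0 ?exprn_ge0 ?enorm_ge0 ?ltW.
have uy1 : e <= u y1.
  suff : dl * enorm y1 ^+ 2 <= e by move: vy1; rewrite /v; lra.
  have A2 : 0 <= 2 * (A + 1) by rewrite mulr_ge0// addr_ge0.
  rewrite /dl mulrAC ler_pdivrMr// ler_pM2l// /B.
  rewrite ler_pXn2r ?nnegrE ?enorm_ge0//.
  by rewrite (le_trans (enorm_le_norm y1))// ler_pM2l.
have y1A' : `|y1| < A + 1.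
  rewrite ltNge; apply/negP => Ay1; move: uy1; apply/negP; rewrite -ltNge.
  by apply: hA => //; rewrite (lt_le_trans _ Ay1)// ltrDl.
have nearA : \forall z \near y1, `|z| < A + 1.
  have : open [set z : 'rV[R]_3 | `|z| < A + 1].
    apply: (@open_comp _ _ (fun y : 'rV[R]_3 => `|y|) [set x | x < A + 1]); last exact: open_lt.
    by move=> y _; exact: norm_continuous.
  by move=> oA; apply: open_nbhs_nbhs.
have loc : \forall z \near y1, D z -> v z <= v y1.
  move: nearA; apply: filterS => z zA Dz; apply: ymax.
  by rewrite inE; split => //=; exact: ltW.
have [Uy1|nUy1] := pselect (U y1).
  apply: (harmonic_no_perturbed_max oU uh Uy1 dl0).
  have : \forall z \near y1, U z by exact: open_nbhs_nbhs.
  by move: loc; apply: filterS2 => z h /UD.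
by apply: (ubd y1 Dy1 nUy1 _ dl dl0 loc); rewrite (lt_le_trans e0).
Qed.

End Harmonic.

(** * Operations on harmonic functions and the exterior Robin problem *)

Section HarmonicOperations.
Context {R : realType}.
Implicit Types (x y v w b : 'rV[R]_3) (f g u : 'rV[R]_3 -> R) (U : set 'rV[R]_3).

Lemma is_derive_partial f y i : differentiable f y ->
  is_derive y (delta_mx 0 i) f (partial i f y).
Proof. by move=> df; apply: derivableP; exact: diff_derivable. Qed.

Lemma harmonic_onC2 U f : C2_on U f -> (forall y, U y -> laplacian f y = 0) ->
  harmonic_on U f.
Proof.
move=> [f1 f2] lf; split.
  by move=> y /f1[df _]; exact: differentiable_continuous.
exists (fun i => partial i f), (fun i => partial i (partial i f)) => y Uy.
split; last exact: lf.
by move=> i; split; apply: is_derive_partial; [case: (f1 y Uy)|case: (f2 i y Uy)].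
Qed.

Lemma harmonic_onS U U' f : U' `<=` U -> harmonic_on U f -> harmonic_on U' f.
Proof.
move=> UU [fc [g [h gh]]]; split; first by move=> y /UU; exact: fc.
by exists g, h => y /UU; exact: gh.
Qed.

Lemma harmonic_onD U f g : harmonic_on U f -> harmonic_on U g ->
  harmonic_on U (fun y => f y + g y).
Proof.
move=> [fc [f1 [f2 hf]]] [gc [g1 [g2 hg]]]; split.
  by move=> y Uy; exact: (continuousD (fc y Uy) (gc y Uy)).
exists (fun i y => f1 i y + g1 i y), (fun i y => f2 i y + g2 i y) => y Uy.
have [df sf] := hf y Uy; have [dg sg] := hg y Uy.
split; last by rewrite big_split/= sf sg addr0.
move=> i; have [df1 df2] := df i; have [dg1 dg2] := dg i.
by split; apply: is_deriveD.
Qed.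

Lemma harmonic_onZ U (a : R) f : harmonic_on U f -> harmonic_on U (fun y => a * f y).
Proof.
move=> [fc [f1 [f2 hf]]]; split.
  by move=> y Uy; exact: (continuousM (cvg_cst a) (fc y Uy)).
exists (fun i y => a * f1 i y), (fun i y => a * f2 i y) => y Uy.
have [df sf] := hf y Uy.
split; last by rewrite -mulr_sumr sf mulr0.
by move=> i; have [df1 df2] := df i; split; apply: is_deriveZ.
Qed.

Lemma is_derive_translate f y v b (d : R) : is_derive (y + b) v f d ->
  is_derive y v (fun z => f (z + b)) d.
Proof.
move=> /is_derive_line df; apply/is_derive_line.
by under eq_fun do rewrite -addrA.
Qed.

Lemma harmonic_on_translate U f b : harmonic_on U f ->
  harmonic_on [set y | U (y + b)] (fun y => f (y + b)).
Proof.
move=> [fc [f1 [f2 hf]]]; split.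
  move=> y /= Uy.
  have h : {for y, continuous (fun z : 'rV[R]_3 => z + b)}.
    apply: differentiable_continuous; apply: differentiableD => //.
  exact: (continuous_comp h (fc _ Uy)).
exists (fun i y => f1 i (y + b)), (fun i y => f2 i (y + b)) => y /= Uy.
have [df sf] := hf _ Uy; split => // i.
by have [df1 df2] := df i; split; apply: is_derive_translate.
Qed.

Lemma is_derive_mulmx f (Q : 'M[R]_3) y v : differentiable f (y *m Q) ->
  is_derive y v (fun z => f (z *m Q))
    (\sum_(j < 3) partial j f (y *m Q) * (v *m Q) 0 j).
Proof.
move=> df; apply/is_derive_line.
have e : (0 *: v + y) *m Q = y *m Q by rewrite scale0r add0r.
rewrite -e; apply: (@is_derive_curve R f (fun h => (h *: v + y) *m Q)).
  by rewrite e.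
move=> i; have -> : (fun s : R => ((s *: v + y) *m Q) 0 i) =
    (fun s : R => s * (v *m Q) 0 i + (y *m Q) 0 i).
  by apply/funext => s; rewrite mulmxDl -scalemxAl !mxE.
by apply: is_derive_eq; rewrite /GRing.scale/=; ring.
Qed.

Lemma mulmx_continuous (Q : 'M[R]_3) : continuous (fun y : 'rV[R]_3 => y *m Q).
Proof.
move=> y; apply: differentiable_continuous.
have -> : (fun y : 'rV[R]_3 => y *m Q) =
    \sum_(j < 3) (fun y => y 0 j *: row j Q).
  by apply/funext => z; rewrite mulmx_sum_row fct_sumE.
apply: differentiable_sum => j; apply: differentiableZl.
exact: differentiable_coord.
Qed.

(** The trace of the Hessian does not depend on the orthonormal basis. *)
Lemma harmonic_on_mulmx U f (Q : 'M[R]_3) : Q^T *m Q = 1%:M ->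
  C2_on U f -> (forall y, U y -> laplacian f y = 0) ->
  harmonic_on [set y | U (y *m Q)] (fun y => f (y *m Q)).
Proof.
move=> QQ [f1 f2] lf; split.
  move=> y /= Uy.
  exact: (continuous_comp (@mulmx_continuous Q y)
    (differentiable_continuous (f1 _ Uy).1)).
exists (fun i y => \sum_(j < 3) partial j f (y *m Q) * Q i j),
  (fun i y => \sum_(j < 3)
     (\sum_(k < 3) partial k (partial j f) (y *m Q) * Q i k) * Q i j) => y /= Uy.
have rQ i j : (delta_mx 0 i *m Q : 'rV[R]_3) 0 j = Q i j by rewrite -rowE mxE.
split.
  move=> i; split.
    apply: is_derive_eq (is_derive_mulmx (delta_mx 0 i) (f1 _ Uy).1) _.
    by apply: eq_bigr => j _; rewrite rQ.
  have D j : is_derive y (delta_mx 0 i) (fun z => partial j f (z *m Q) * Q i j)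
      ((\sum_(k < 3) partial k (partial j f) (y *m Q) * Q i k) * Q i j).
    have d : is_derive y (delta_mx 0 i) (fun z => partial j f (z *m Q))
        (\sum_(k < 3) partial k (partial j f) (y *m Q) * Q i k).
      apply: is_derive_eq (is_derive_mulmx (delta_mx 0 i) (f2 j _ Uy).1) _.
      by apply: eq_bigr => k _; rewrite rQ.
    have -> : (fun z => partial j f (z *m Q) * Q i j) =
      (fun z => Q i j * partial j f (z *m Q)) by apply/funext => z; rewrite mulrC.
    by rewrite mulrC; apply: is_deriveZ.
  have -> : (fun y0 => \sum_(j < 3) partial j f (y0 *m Q) * Q i j) =
     \sum_(j < 3) (fun z => partial j f (z *m Q) * Q i j).
    by apply/funext => z; rewrite fct_sumE.
  exact: is_derive_sum.
rewrite -[RHS](lf _ Uy) /laplacian.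
under eq_bigr => i _ do under eq_bigr => j _ do rewrite mulr_suml.
rewrite exchange_big/=; apply: eq_bigr => j _.
rewrite exchange_big/= (bigD1 j)//= [X in _ + X]big1 ?addr0.
  under eq_bigr do rewrite -mulrA; rewrite -mulr_sumr.
  suff -> : \sum_(i < 3) Q i j * Q i j = 1 by rewrite mulr1.
  transitivity ((Q^T *m Q) j j); last by rewrite QQ mxE eqxx.
  by rewrite mxE; apply: eq_bigr => i _; rewrite mxE.
move=> k kj; under eq_bigr do rewrite -mulrA; rewrite -mulr_sumr.
suff -> : \sum_(i < 3) Q i k * Q i j = 0 by rewrite mulr0.
transitivity ((Q^T *m Q) k j); last by rewrite QQ mxE (negPf kj).
by rewrite mxE; apply: eq_bigr => i _; rewrite mxE.
Qed.

Lemma is_deriveV_fun f y v (d : R) : f y != 0 -> is_derive y v f d ->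
  is_derive y v (fun z => (f z)^-1) (- (f y) ^- 2 * d).
Proof.
move=> fy [df <-]; constructor; first exact: derivableV.
by rewrite deriveV.
Qed.

(** The Newtonian potential. *)
Lemma harmonic_inv_enorm : harmonic_on [set y | y != 0] (fun y => (enorm y)^-1).
Proof.
split.
  move=> y /= y0; have n0 : enorm y != 0 by rewrite enorm_eq0.
  exact: (continuousV n0 (@enorm_continuous R y)).
exists (fun i y => - y 0 i * (enorm y)^-1 ^+ 3),
  (fun i y => - (enorm y)^-1 ^+ 3 + 3 * y 0 i ^+ 2 * (enorm y)^-1 ^+ 5) => y /= y0.
have n0 : enorm y != 0 by rewrite enorm_eq0.
split.
  move=> i; have dn : is_derive y (delta_mx 0 i) (fun z => (enorm z)^-1)
      (- y 0 i * (enorm y)^-1 ^+ 3).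
    apply: is_derive_eq (is_deriveV_fun n0 (is_derive_enorm i y0)) _.
    by field.
  split=> //.
  have dc : is_derive y (delta_mx 0 i) (fun z : 'rV[R]_3 => z 0 i) 1.
    by have := is_derive_coord y (delta_mx 0 i) i; rewrite mxE !eqxx.
  have -> : (fun y0 => - y0 0 i * (enorm y0)^-1 ^+ 3) =
     - (fun z : 'rV[R]_3 => z 0 i) * (fun z => (enorm z)^-1) ^+ 3.
    by apply/funext => z; rewrite exprfctE.
  apply: is_derive_eq; rewrite /GRing.scale/= exprfctE/=.
  by rewrite opprfctE; field.
rewrite big_split/= sumr_const -mulr_suml -mulr_sumr -sqr_enorm card_ord.
by rewrite -mulr_natr; field.
Qed.

(** A positive boundary maximum is excluded when [u] does not decrease outwards
    along the normal: the perturbation of [max_principle] then strictly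
    increases along it. *)
Lemma exterior_robin u : {within @ext1 R `|` @sphere1 R, continuous u} ->
  harmonic_on (@ext1 R) u ->
  (forall e : R, 0 < e -> exists A : R, forall y, A < enorm y -> u y < e) ->
  (forall w, sphere1 w -> 0 < u w -> \forall r \near 1^'+, u w <= u (r *: w)) ->
  forall y, 1 <= enorm y -> u y <= 0.
Proof.
move=> uc uh uinf urob y y1.
apply: (max_principle closed_ext open_ext1 _ uc uh); last 1 first.
- by rewrite ext_closureE.
- exact: subsetUl.
- move=> e /uinf[A hA]; exists A => z _ Az; apply: hA.
  exact: lt_le_trans Az (norm_le_enorm z).
move=> w Dw nUw uw e e0 wmax.
have w1 : sphere1 w by case: Dw.
have cw : (fun r : R => r *: w) r @[r --> 1^'+] --> w.
  apply: cvg_at_right_filter; rewrite -[X in _ --> X]scale1r.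
  exact: scalel_continuous.
have h1 := cw _ wmax; have h2 := urob w w1 uw.
near (1:R)^'+ => r.
have r1 : 1 < r by near: r; exact: nbhs_right_gt.
have h3 : u w <= u (r *: w) by near: r.
have nr : enorm (r *: w) = r by rewrite enormZ w1 mulr1 gtr0_norm// (lt_trans ltr01).
have : u (r *: w) + e * enorm (r *: w) ^+ 2 <= u w + e * enorm w ^+ 2.
  have : (@ext1 R `|` @sphere1 R) (r *: w) by left; rewrite /ext1/= nr.
  by near: r.
rewrite nr w1 expr1n mulr1 => h4.
have : e < e * r ^+ 2 by rewrite ltr_pMr// exprn_egt1.
by lra.
Unshelve. all: by end_near. Qed.

End HarmonicOperations.

(** * Second differences of a harmonic function of degree one *)

Section DegreeOne.
Context {R : realType}.
Implicit Types (x y z v w h : 'rV[R]_3) (F : 'rV[R]_3 -> R).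

Lemma sphere1_neq0 y : sphere1 y -> y != 0.
Proof. by move=> y1; rewrite -enorm_eq0 y1 oner_eq0. Qed.

Lemma partial_osc_near F (U : set 'rV[R]_3) x (e : R) : open U -> C1_on U F ->
  U x -> 0 < e ->
  exists2 r : R, 0 < r & forall z, `|z - x| < r ->
    U z /\ forall i, `|partial i F z - partial i F x| < e.
Proof.
move=> oU F1 Ux e0.
have H : \forall z \near x, U z /\ forall i, `|partial i F z - partial i F x| < e.
  have H1 : \forall z \near x, U z by exact: open_nbhs_nbhs.
  have H2 : \forall z \near x, forall i, `|partial i F z - partial i F x| < e.
    have fi (i : 'I_3) : \forall z \near x, `|partial i F z - partial i F x| < e.
      have [_ /(_ i) c] := F1 x Ux.
      have /cvgrPdist_lt/(_ e e0) := c.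
      by apply: filterS => z; rewrite distrC.
    exact: (filter_forall _ fi).
  exact: filterS2 H1 H2.
have /nbhs_ballP[r /= r0 hr] := H.
exists r => // z zr; apply: hr.
by rewrite -ball_normE /= distrC.
Qed.

(** Both increments of [F] are given by the mean value theorem with gradients
    evaluated near [x]; by continuity these gradients nearly cancel. *)
Lemma second_difference_local F (U : set 'rV[R]_3) x (e : R) : open U -> C1_on U F ->
  U x -> 0 < e ->
  \forall w \near x & h \near (0 : 'rV[R]_3),
    `|F (w + h) + F (w - h) - 2 * F w| <= e * `|h|.
Proof.
move=> oU F1 Ux e0.
(* Three coordinates, and two partial derivatives compared with their value at
   [x] in each of them. *)
have e6 : 0 < e / 6 by rewrite divr_gt0.
have [r r0 hr] := partial_osc_near oU F1 Ux e6.
have r2 : 0 < r / 2 by rewrite divr_gt0.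
exists (ball x (r / 2), ball (0 : 'rV[R]_3) (r / 2)).
  by split; exact: nbhsx_ballx.
move=> [w h] /= []; rewrite -!ball_normE/= sub0r normrN distrC => wx hn.
have seg (s : R) : -1 <= s <= 1 -> `|s *: h + w - x| < r.
  move=> s1; rewrite -addrA (le_lt_trans (ler_normD _ _))// (splitr r) ltrD//.
  rewrite normrZ; apply: le_lt_trans hn; rewrite -[leRHS]mul1r ler_wpM2r//.
  by rewrite ler_norml.
pose p (s : R) := F (s *: h + w).
pose dp (s : R) := \sum_(i < 3) partial i F (s *: h + w) * h 0 i.
have dpP (s : R) : -1 <= s <= 1 -> is_derive s 1 p (dp s).
  move=> /seg /hr[Us _].
  apply: (@is_derive_curve R F (fun s => s *: h + w) h s (F1 _ Us).1) => i.
  have -> : (fun s0 : R => (s0 *: h + w) 0 i) = (fun s : R => s * h 0 i + w 0 i).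
    by apply/funext => t; rewrite !mxE.
  by apply: is_derive_eq; rewrite /GRing.scale/=; ring.
have mvt (a b : R) : -1 <= a -> a < b -> b <= 1 ->
    exists2 c, -1 <= c <= 1 & p b - p a = dp c * (b - a).
  move=> a1 ab b1.
  have [||c cab E] := @MVT _ p dp a b ab.
  - move=> t; rewrite in_itv/= => /andP[at' tb]; apply: dpP.
    by rewrite (le_trans a1 (ltW at')) (le_trans (ltW tb) b1).
  - apply: derivable_within_continuous => t; rewrite in_itv/= => /andP[at' tb].
    have [|//] := dpP t.
    by rewrite (le_trans a1 at') (le_trans tb b1).
  - exists c => //; move: cab; rewrite in_itv/= => /andP[ac cb].
    by rewrite (le_trans a1 (ltW ac)) (le_trans (ltW cb) b1).
have [|||c c1 E1] := mvt 0 1; rewrite ?ltr01// ?lerN10//.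
have [|||d d1 E2] := mvt (-1) 0; rewrite ?ltrN10// ?ler01//.
have -> : F (w + h) + F (w - h) - 2 * F w = dp c - dp d.
  move: E1 E2; rewrite /p scale1r scale0r add0r scaleN1r subr0 opprK add0r !mulr1.
  by rewrite [h + w]addrC [- h + w]addrC => <- <-; ring.
rewrite /dp -sumrB (le_trans (ler_norm_sum _ _ _))//.
apply: (@le_trans _ _ (\sum_(i < 3) (e / 6 + e / 6) * `|h|)).
  apply: ler_sum => i _; rewrite -mulrBl normrM ler_pM//; last exact: coord_le_norm.
  have -> : partial i F (c *: h + w) - partial i F (d *: h + w) =
    (partial i F (c *: h + w) - partial i F x) -
    (partial i F (d *: h + w) - partial i F x) by ring.
  rewrite (le_trans (ler_normB _ _))// lerD// ltW//.
    by have [_] := hr _ (seg c c1); apply.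
  by have [_] := hr _ (seg d d1); apply.
by rewrite sum3; lra.
Qed.

Lemma open_neq0 : open [set y : 'rV[R]_3 | y != 0].
Proof.
have -> : [set y : 'rV[R]_3 | y != 0] = @enorm R @^-1` [set x | 0 < x].
  by apply/seteqP; split => y /=; rewrite enorm_gt0.
apply: open_comp; last exact: open_gt.
by move=> y _; exact: enorm_continuous.
Qed.

Section Homogeneous.
Variable F : 'rV[R]_3 -> R.
Hypothesis F_hom : forall (s : R) y, 0 < s -> F (s *: y) = s * F y.
Hypothesis F_C1 : C1_on [set y | y != 0] F.
Hypothesis F_harm : harmonic_on [set y | y != 0] F.

Let F0 : F 0 = 0.
Proof. by have := @F_hom 2 0 (ltr0Sn _ 1); rewrite scaler0 => h; lra. Qed.

(** By homogeneity this estimate, uniform on the sphere, gives the decay of the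
    second difference of [F] at infinity. *)
Lemma second_difference_sphere (e : R) : 0 < e ->
  exists2 d : R, 0 < d & forall w h, sphere1 w -> `|h| < d ->
    `|F (w + h) + F (w - h) - 2 * F w| <= e * `|h|.
Proof.
move=> e0.
have /compact_near_coveringP cov := @compact_sphere1 R.
have : \forall h \near (0 : 'rV[R]_3), forall w, sphere1 w ->
    `|F (w + h) + F (w - h) - 2 * F w| <= e * `|h|.
  apply: (cov _ (nbhs (0 : 'rV[R]_3))
    (fun h w => `|F (w + h) + F (w - h) - 2 * F w| <= e * `|h|) _) => x x1.
  exact: (second_difference_local open_neq0 F_C1 (sphere1_neq0 x1)).
move=> /nbhs_ballP[d /= d0 hd].
exists d => // w h w1 hh; apply: hd => //=.
by rewrite -ball_normE/= sub0r normrN.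
Qed.

Lemma degree1_bound : exists2 C : R, 0 <= C & forall y, `|F y| <= C * `|y|.
Proof.
have c : {within @sphere1 R, continuous F}.
  apply: continuous_in_subspaceT => y; rewrite inE => y1.
  apply: differentiable_continuous; apply: (F_C1 _).1.
  by rewrite /= -enorm_eq0 y1 oner_eq0.
have /ex_strict_bound_gt0[C C0 hC] : bounded_set (F @` @sphere1 R).
  exact/compact_bounded/continuous_compact/compact_sphere1.
exists (2 * C); first by rewrite mulr_ge0// ltW.
move=> y; have [->|y0] := eqVneq y 0; first by rewrite F0 !normr0 mulr0.
have n0 : 0 < enorm y by rewrite enorm_gt0.
have -> : F y = enorm y * F ((enorm y)^-1 *: y).
  by rewrite -F_hom// scalerA divff ?gt_eqF// scale1r.
rewrite normrM gtr0_norm// (_ : 2 * C * `|y| = 2 * `|y| * C); last by ring.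
rewrite ler_pM ?enorm_ge0// ?enorm_le_norm//.
apply/ltW/hC; exists ((enorm y)^-1 *: y) => //.
exact: normalize_enorm.
Qed.

(** The second difference [G] is harmonic except at the three points where one
    of [z], [z + h], [z - h] vanishes. Subtracting [e] times the sum [N] of the
    Newtonian potentials of these points makes it negative near them, because
    [G] is bounded there; as [G] tends to [0] at infinity, the maximum principle
    gives [G <= e * N]. *)
Lemma second_difference_le0 y h : y != 0 -> y + h != 0 -> y - h != 0 ->
  F (y + h) + F (y - h) - 2 * F y <= 0.
Proof.
move=> y0 yph ymh.
pose G z := F (z + h) + F (z - h) + - 2 * F z.
pose N z := (enorm z)^-1 + (enorm (z + h))^-1 + (enorm (z - h))^-1.
rewrite -mulNr -/(G y) leNgt; apply/negP => Gy.
have Ny : 0 < N y.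
  by rewrite /N !addr_gt0// invr_gt0 enorm_gt0.
(* With this [e] the bound [G y <= e * N y] reads [G y <= G y / 2]. *)
pose e := G y / (2 * N y).
have e0 : 0 < e by rewrite divr_gt0// mulr_gt0.
have [C C0 hC] := degree1_bound.
(* [B] bounds [G] at the points within distance [1] of a singularity; [m] is
   small enough for [e / m] to exceed [B] and for [y] to stay in the domain. *)
pose B := C * (4 + 6 * `|h|).
have B0 : 0 <= B by rewrite mulr_ge0// addr_ge0// mulr_ge0.
have eB : 0 < e / (B + 1) by rewrite divr_gt0// ltr_wpDl.
pose m := Num.min (Num.min 1 (e / (B + 1)))
  (Num.min (enorm y) (Num.min (enorm (y + h)) (enorm (y - h)))).
have m0 : 0 < m by rewrite !lt_min ltr01 eB !enorm_gt0 y0 yph ymh.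
have m1 : m <= 1 by rewrite !ge_min lexx.
have me : m <= e / (B + 1) by rewrite !ge_min lexx orbT.
pose D := [set z | m <= enorm z] `&` [set z | m <= enorm (z + h)] `&`
  [set z | m <= enorm (z - h)].
pose U := [set z | m < enorm z] `&` [set z | m < enorm (z + h)] `&`
  [set z | m < enorm (z - h)].
have cshift b : continuous (fun z : 'rV[R]_3 => enorm (z + b)).
  move=> z; apply: (@continuous_comp _ _ _ (fun z => z + b) (@enorm R));
    last exact: enorm_continuous.
  by apply: differentiable_continuous; apply: differentiableD.
have cl b : closed [set z | m <= enorm (z + b)].
  apply: (@closed_comp _ _ (fun z => enorm (z + b)) [set x | m <= x]).
    by move=> z _; exact: cshift.
  exact: closed_ge.
have op b : open [set z | m < enorm (z + b)].
  apply: (@open_comp _ _ (fun z => enorm (z + b)) [set x | m < x]).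
    by move=> z _; exact: cshift.
  exact: open_gt.
have cD : closed D.
  apply: closedI; last exact: cl.
  by apply: closedI => //; have := cl 0; under eq_set do rewrite addr0.
have oU : open U.
  apply: openI; last exact: op.
  by apply: openI => //; have := op 0; under eq_set do rewrite addr0.
have UD : U `<=` D by move=> z [[/= /ltW ? /ltW ?] /ltW ?].
pose W := [set z | [/\ z != 0, z + h != 0 & z - h != 0]].
have DW : D `<=` W.
  by move=> z [[/= d1 d2] d3]; split; rewrite -enorm_gt0 (lt_le_trans m0).
pose u z := G z + - e * N z.
have uW : harmonic_on W u.
  have h1 : W `<=` [set z | z != 0] by move=> z [].
  have h2 : W `<=` [set z | [set z | z != 0] (z + h)] by move=> z [].
  have h3 : W `<=` [set z | [set z | z != 0] (z - h)] by move=> z [].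
  have hN := @harmonic_inv_enorm R.
  apply: harmonic_onD.
    apply: harmonic_onD; [apply: harmonic_onD|].
    - exact: harmonic_onS h2 (harmonic_on_translate h F_harm).
    - exact: harmonic_onS h3 (harmonic_on_translate (- h) F_harm).
    - exact: harmonic_onZ (harmonic_onS h1 F_harm).
  apply: harmonic_onZ; apply: harmonic_onD; [apply: harmonic_onD|].
  - exact: harmonic_onS h1 hN.
  - exact: harmonic_onS h2 (harmonic_on_translate h hN).
  - exact: harmonic_onS h3 (harmonic_on_translate (- h) hN).
have Dy : D y.
  by split; [split|]; rewrite /= !ge_min lexx !orbT.
have : u y <= 0.
  apply: (max_principle cD oU UD _ (harmonic_onS (subset_trans UD DW) uW)) => //.
  - apply: continuous_in_subspaceT => z; rewrite inE => /DW; exact: uW.1.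
  - move=> e' e'0.
    have he' : 0 < e' / (`|h| + 1) by rewrite divr_gt0// ltr_wpDl.
    have [d d0 hd] := second_difference_sphere he'.
    exists (`|h| / d) => z /DW[z0 zh1 zh2] Az.
    have nz : 0 < enorm z by rewrite enorm_gt0.
    pose k := (enorm z)^-1 *: h.
    have nk : `|k| = `|h| / enorm z.
      by rewrite normrZ gtr0_norm ?invr_gt0// mulrC.
    have kd : `|k| < d.
      rewrite nk ltr_pdivrMr// -ltr_pdivrMl// mulrC.
      exact: lt_le_trans Az (norm_le_enorm z).
    have GE : G z = enorm z * (F ((enorm z)^-1 *: z + k) +
        F ((enorm z)^-1 *: z - k) - 2 * F ((enorm z)^-1 *: z)).
      have s b : enorm z * F ((enorm z)^-1 *: b) = F b.
        by rewrite -F_hom// scalerA divff ?gt_eqF// scale1r.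
      rewrite /k -scalerDr -scalerBr mulrBr mulrDr !s mulrCA s /G mulNr.
      by [].
    have := hd _ k (normalize_enorm z0) kd.
    rewrite nk => hk.
    have Gz : G z <= e' / (`|h| + 1) * `|h|.
      rewrite GE (le_trans (ler_norm _))// normrM gtr0_norm//.
      rewrite -ler_pdivlMl// (le_trans hk)// mulrA [leRHS]mulrC.
      by rewrite lexx.
    have Gz' : G z < e'.
      apply: le_lt_trans Gz _; rewrite mulrAC ltr_pdivrMr ?ltr_wpDl//.
      by rewrite ltr_pM2l// ltrDl.
    have Nz : 0 <= e * N z.
      apply: mulr_ge0; first exact: ltW.
      by rewrite /N !addr_ge0// ?invr_ge0 ?enorm_ge0.
    by rewrite /u mulNr; lra.
  - move=> w Dw nUw uw; exfalso; move: uw; apply/negP; rewrite -leNgt.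
    have [[/= d1 d2] d3] := Dw.
    have [wm Nw] : (`|w| <= 1 + `|h|) /\ m^-1 <= N w.
      have n0 b : 0 <= (enorm b)^-1 :> R by rewrite invr_ge0 enorm_ge0.
      have := n0 w; have := n0 (w + h); have := n0 (w - h) => i1 i2 i3.
      have [e1|e1] := eqVneq m (enorm w).
        split; last by rewrite /N e1; lra.
        rewrite (le_trans (norm_le_enorm w))// -e1 (le_trans m1)// lerDl//.
      have [e2|e2] := eqVneq m (enorm (w + h)).
        split; last by rewrite /N e2; lra.
        rewrite -[X in `|X|](addrK h) (le_trans (ler_normB _ _))// lerD2r.
        by rewrite (le_trans (norm_le_enorm _))// -e2.
      have [e3|e3] := eqVneq m (enorm (w - h)).
        split; last by rewrite /N e3; lra.
        rewrite -[X in `|X|](subrK h) (le_trans (ler_normD _ _))// lerD2r.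
        by rewrite (le_trans (norm_le_enorm _))// -e3.
      by exfalso; apply: nUw; split; [split|]; rewrite /= lt_neqAle ?e1 ?e2 ?e3.
    have GB : G w <= B.
      have f1 := hC (w + h); have f2 := hC (w - h); have f3 := hC w.
      have g1 : `|F (w + h)| <= C * (1 + 2 * `|h|).
        rewrite (le_trans f1)// ler_wpM2l// (le_trans (ler_normD _ _))//.
        by move: wm; lra.
      have g2 : `|F (w - h)| <= C * (1 + 2 * `|h|).
        rewrite (le_trans f2)// ler_wpM2l// (le_trans (ler_normB _ _))//.
        by move: wm; lra.
      have g3 : `|F w| <= C * (1 + `|h|) by rewrite (le_trans f3)// ler_wpM2l.
      have := ler_norm (F (w + h)); have := ler_norm (F (w - h)).
      have := lerNnormlW (lexx `|F w|); rewrite /G /B; lra.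
    have NB : B + 1 <= e * N w.
      apply: le_trans (_ : e * m^-1 <= _); last by rewrite ler_pM2l.
      by rewrite ler_pdivlMr// mulrC -ler_pdivlMr ?ltr_wpDl.
    by rewrite /u mulNr; lra.
have -> : u y = G y / 2.
  by rewrite /u /e; field; rewrite gt_eqF.
by rewrite leNgt divr_gt0.
Qed.

End Homogeneous.

End DegreeOne.

(** * Linearity of harmonic functions of degree one *)

Section DegreeOneLinear.
Context {R : realType}.
Implicit Types (x y z v w h : 'rV[R]_3) (f F : 'rV[R]_3 -> R).

Lemma continuous_near_eq f g y : (\near y, f y = g y) ->
  {for y, continuous f} -> {for y, continuous g}.
Proof.
move=> fg fc; have fgy : f y = g y by exact: (nbhs_singleton fg).
rewrite /prop_for /continuous_at -fgy; apply: cvg_trans fc.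
exact: (@near_eq_cvg _ _ (nbhs y)).
Qed.

Lemma C1_onN (U : set 'rV[R]_3) f : open U -> C1_on U f ->
  C1_on U (fun y => - f y).
Proof.
move=> oU f1 y Uy; split; first by apply: differentiableN; case: (f1 y Uy).
move=> i; apply: (@continuous_near_eq (fun z => - partial i f z)).
  have : \near y, U y by exact: open_nbhs_nbhs.
  apply: filterS => z /f1[df _].
  by rewrite /partial deriveN//; exact: diff_derivable.
by apply: continuousN; apply: (f1 y Uy).2.
Qed.

Variable F : 'rV[R]_3 -> R.
Hypothesis F_hom : forall (s : R) y, 0 < s -> F (s *: y) = s * F y.
Hypothesis F_C1 : C1_on [set y | y != 0] F.
Hypothesis F_harm : harmonic_on [set y | y != 0] F.

Let F0 : F 0 = 0.
Proof. by have := @F_hom 2 0 (ltr0Sn _ 1); rewrite scaler0 => h; lra. Qed.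

(** The inequality for [F] and for [- F]. *)
Let F_midpoint y h : y != 0 -> y + h != 0 -> y - h != 0 ->
  F (y + h) + F (y - h) = 2 * F y.
Proof.
move=> y0 yph ymh.
have h1 := second_difference_le0 F_hom F_C1 F_harm y0 yph ymh.
have NF_hom (s : R) z : 0 < s -> - F (s *: z) = s * - F z.
  by move=> s0; rewrite F_hom// mulrN.
have NF_C1 : C1_on [set y | y != 0] (fun z => - F z).
  by apply: C1_onN F_C1; exact: open_neq0.
have NF_harm : harmonic_on [set y | y != 0] (fun z => - F z).
  have -> : (fun z => - F z) = (fun z => -1 * F z).
    by apply/funext => z; rewrite mulN1r.
  exact: harmonic_onZ.
have := second_difference_le0 NF_hom NF_C1 NF_harm y0 yph ymh.
by lra.
Qed.

(** The midpoint identity at [(a + b) / 2], followed by homogeneity. *)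
Let F_addition a b : a != 0 -> b != 0 -> a + b != 0 -> F (a + b) = F a + F b.
Proof.
move=> a0 b0 ab0.
have E (c : 'rV[R]_3) : (2^-1 : R) *: (c + c) = c.
  by apply/rowP => i; rewrite !mxE; lra.
pose y := (2^-1 : R) *: (a + b); pose h := (2^-1 : R) *: (a - b).
have ya : y + h = a by rewrite /y /h -scalerDr addrACA subrr addr0 E.
have yb : y - h = b by rewrite /y /h -scalerBr opprB addrACA [a + b]addrC addrACA subrr addr0 E.
have y0 : y != 0 by rewrite scaler_eq0 negb_or ab0 invr_eq0 pnatr_eq0.
have := @F_midpoint y h y0; rewrite ya yb => /(_ a0 b0) ->.
rewrite -F_hom// /y scalerA mulfV ?scale1r//.
Qed.

(** The midpoint identity says nothing when the midpoint is the origin, so the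
    decomposition [a = 2 a + (- a)] is used instead. *)
Let F_opp a : F (- a) = - F a.
Proof.
have [->|a0] := eqVneq a 0; first by rewrite oppr0 F0 oppr0.
have a2 : (2 : R) *: a != 0 by rewrite scaler_eq0 negb_or a0 pnatr_eq0.
have e : (2 : R) *: a - a = a by rewrite scaler_nat mulr2n addrK.
have := @F_addition ((2 : R) *: a) (- a) a2; rewrite oppr_eq0 e => /(_ a0 a0).
by rewrite F_hom//; lra.
Qed.

Lemma degree1_harmonicD a b : F (a + b) = F a + F b.
Proof.
have [->|a0] := eqVneq a 0; first by rewrite F0 !add0r.
have [->|b0] := eqVneq b 0; first by rewrite F0 !addr0.
have [ab0|] := eqVneq (a + b) 0; last exact: F_addition.
by rewrite ab0 F0 (_ : b = - a) ?F_opp ?subrr//; apply/eqP; rewrite -addr_eq0 addrC ab0.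
Qed.

Lemma degree1_harmonicZ s a : F (s *: a) = s * F a.
Proof.
have [s0|s0|->] := ltgtP s 0; last by rewrite scale0r F0 mul0r.
  have -> : s *: a = - ((- s) *: a) by rewrite scaleNr opprK.
  by rewrite F_opp F_hom ?oppr_gt0// mulNr opprK.
exact: F_hom.
Qed.

Lemma degree1_harmonic_linear y : F y = \sum_(i < 3) y 0 i * F (delta_mx 0 i).
Proof.
rewrite {1}(row_partial_basis y) !big_ord_recl !big_ord0 !addr0.
by rewrite !degree1_harmonicD !degree1_harmonicZ.
Qed.

End DegreeOneLinear.

(** * Spherical coordinates *)

Section SphericalCurves.
Context {R : realType}.
Implicit Types (r th ph : R) (y : 'rV[R]_3).

Lemma ord3P (P : 'I_3 -> Prop) : P 0 -> P 1 -> P 2%:R -> forall i, P i.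
Proof.
move=> P0 P1 P2 [[|[|[|//]]] i3].
- by rewrite (_ : Ordinal i3 = 0)//; apply/val_inj.
- by rewrite (_ : Ordinal i3 = 1)//; apply/val_inj.
- by rewrite (_ : Ordinal i3 = 2%:R)//; apply/val_inj.
Qed.

Lemma mk3_0 (a b c : R) : mk3 a b c 0 0 = a. Proof. by rewrite mxE. Qed.
Lemma mk3_1 (a b c : R) : mk3 a b c 0 1 = b. Proof. by rewrite mxE. Qed.
Lemma mk3_2 (a b c : R) : mk3 a b c 0 2%:R = c. Proof. by rewrite mxE. Qed.
Definition mk3E := (mk3_0, mk3_1, mk3_2).

(** The first derivatives of [sph r th ph] in [th] and in [ph], and the second
    derivative in [ph]; the second derivative in [th] is [- sph r th ph]. *)
Definition sph_th r th ph : 'rV[R]_3 :=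
  mk3 (r * cos th * cos ph) (r * cos th * sin ph) (- r * sin th).
Definition sph_ph r th ph : 'rV[R]_3 :=
  mk3 (- r * sin th * sin ph) (r * sin th * cos ph) 0.
Definition sph_phph r th ph : 'rV[R]_3 :=
  mk3 (- r * sin th * cos ph) (- r * sin th * sin ph) 0.

Lemma is_derive_sph_r r th ph i :
  is_derive r 1 (fun s => sph s th ph 0 i) (sph 1 th ph 0 i).
Proof.
elim/ord3P : i; rewrite /sph !mk3E; under eq_fun do rewrite !mk3E;
  by apply: is_derive_eq; rewrite /GRing.scale/=; ring.
Qed.

Lemma is_derive_sph_th r th ph i :
  is_derive th 1 (fun s => sph r s ph 0 i) (sph_th r th ph 0 i).
Proof.
elim/ord3P : i; rewrite /sph_th /sph !mk3E; under eq_fun do rewrite !mk3E;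
  by apply: is_derive_eq; rewrite /GRing.scale/=; ring.
Qed.

Lemma is_derive_sph_thth r th ph i :
  is_derive th 1 (fun s => sph_th r s ph 0 i) (- sph r th ph 0 i).
Proof.
elim/ord3P : i; rewrite /sph_th /sph !mk3E; under eq_fun do rewrite !mk3E;
  by apply: is_derive_eq; rewrite /GRing.scale/=; ring.
Qed.

Lemma is_derive_sph_ph r th ph i :
  is_derive ph 1 (fun s => sph r th s 0 i) (sph_ph r th ph 0 i).
Proof.
elim/ord3P : i; rewrite /sph_ph /sph !mk3E; under eq_fun do rewrite !mk3E;
  by apply: is_derive_eq; rewrite /GRing.scale/=; ring.
Qed.

Lemma is_derive_sph_phph r th ph i :
  is_derive ph 1 (fun s => sph_ph r th s 0 i) (sph_phph r th ph 0 i).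
Proof.
elim/ord3P : i; rewrite /sph_phph /sph_ph !mk3E; under eq_fun do rewrite !mk3E;
  by apply: is_derive_eq; rewrite /GRing.scale/=; ring.
Qed.

Lemma sphZ s r th ph : s *: sph r th ph = sph (s * r) th ph.
Proof. by apply/rowP; elim/ord3P; rewrite mxE /sph !mk3E; ring. Qed.

Lemma enorm_sph r th ph : enorm (sph r th ph) = `|r|.
Proof.
have -> : sph r th ph = r *: sph 1 th ph by rewrite sphZ mulr1.
rewrite enormZ -[RHS]mulr1; congr (_ * _).
suff : enorm (sph 1 th ph) ^+ 2 = 1.
  by move/eqP; rewrite sqrp_eq1 ?enorm_ge0// => /eqP.
rewrite sqr_enorm sum3 /sph !mk3E.
transitivity (cos th ^+ 2 + (cos ph ^+ 2 + sin ph ^+ 2) * sin th ^+ 2).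
  by ring.
by rewrite cos2Dsin2 mul1r cos2Dsin2.
Qed.

Lemma sph_neq0 r th ph : 0 < r -> sph r th ph != 0.
Proof. by move=> r0; rewrite -enorm_gt0 enorm_sph normr_gt0 gt_eqF. Qed.

(** The arccosine only covers the upper half circle; the lower half is reached
    by changing its sign. *)
Lemma unit_circle_angle (a b : R) : a ^+ 2 + b ^+ 2 = 1 ->
  exists ph, a = cos ph /\ b = sin ph.
Proof.
move=> ab; have a1 : -1 <= a <= 1.
  rewrite -ler_norml -(@ler_pXn2r _ 2)// ?nnegrE// expr1n real_normK ?num_real//.
  by have := sqr_ge0 b; lra.
have c : cos (acos a) = a by apply: acosK; rewrite in_itv.
have s : sin (acos a) = `|b|.
  by rewrite sin_acos// -sqrtr_sqr; congr Num.sqrt; lra.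
have [b0|b0] := leP 0 b.
  by exists (acos a); rewrite c s ger0_norm.
by exists (- acos a); rewrite cosN sinN c s ltr0_norm// opprK.
Qed.

Lemma sph_surj y : exists th ph, 0 <= th <= pi /\ y = sph (enorm y) th ph.
Proof.
have [->|y0] := eqVneq y 0.
  exists 0, 0; rewrite lexx pi_ge0; split=> //.
  have -> : enorm 0 = 0 :> R by apply/eqP; rewrite enorm_eq0.
  by apply/rowP; elim/ord3P; rewrite mxE /sph !mk3E; ring.
have n0 : 0 < enorm y by rewrite enorm_gt0.
suff [th [ph [thpi E]]] : exists th ph, 0 <= th <= pi /\
    (enorm y)^-1 *: y = sph 1 th ph.
  exists th, ph; split=> //.
  by rewrite -[X in sph X]mulr1 -sphZ -E scalerA divff ?gt_eqF// scale1r.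
set w := (enorm y)^-1 *: y; have w1 : enorm w = 1 := normalize_enorm y0.
have ws : w 0 0 ^+ 2 + w 0 1 ^+ 2 + w 0 2%:R ^+ 2 = 1.
  by have := sqr_enorm w; rewrite sum3 w1 expr1n => <-.
have z1 : -1 <= w 0 2%:R <= 1 by rewrite -ler_norml -w1 coord_le_enorm.
have c : cos (acos (w 0 2%:R)) = w 0 2%:R by apply: acosK; rewrite in_itv.
set th := acos (w 0 2%:R) in c *.
have thpi : 0 <= th <= pi by rewrite acos_ge0// acos_lepi.
have cs := cos2Dsin2 th.
have [s0|s0] := eqVneq (sin th) 0.
  have w0 : w 0 0 = 0 /\ w 0 1 = 0.
    move: cs; rewrite s0 c => cs.
    have a0 := sqr_ge0 (w 0 0); have b0 := sqr_ge0 (w 0 1).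
    by split; apply/eqP; rewrite -sqrf_eq0; apply/eqP; lra.
  exists th, 0; split=> //.
  apply/rowP; elim/ord3P; rewrite /sph !mk3E ?s0 ?w0.1 ?w0.2 ?c; ring.
have [|ph [pc ps]] := @unit_circle_angle (w 0 0 / sin th) (w 0 1 / sin th).
  rewrite !expr_div_n -mulrDl.
  have -> : w 0 0 ^+ 2 + w 0 1 ^+ 2 = sin th ^+ 2 by move: cs; rewrite c; lra.
  by rewrite divff// expf_neq0.
exists th, ph; split=> //.
by apply/rowP; elim/ord3P; rewrite /sph !mk3E -?pc -?ps ?c mul1r// mulrC divfK.
Qed.

Lemma sph_continuous_th r ph : continuous (fun s => sph r s ph).
Proof.
move=> th; apply: differentiable_continuous; apply/derivable1_diffP.
apply/derivable_mxP => i j; rewrite (ord1 i).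
by have [] := is_derive_sph_th r th ph j.
Qed.

End SphericalCurves.

(** * The Laplace-Beltrami operator and its eigenvalue -2 *)

Section LaplaceBeltrami.
Context {R : realType}.
Implicit Types (r th ph : R) (y w : 'rV[R]_3).

Lemma is_derive1E (f : R -> R) (t d : R) : is_derive t 1 f d -> derive1 f t = d.
Proof. by move=> df; rewrite derive1E; exact: derive_val. Qed.

Lemma is_derive_sum_fun (f : 'I_3 -> R -> R) (d : 'I_3 -> R) (t : R) :
  (forall i, is_derive t 1 (f i) (d i)) ->
  is_derive t 1 (fun s => \sum_(i < 3) f i s) (\sum_(i < 3) d i).
Proof.
move=> fd; have -> : (fun s => \sum_(i < 3) f i s) = \sum_(i < 3) f i.
  by apply/funext => s; rewrite fct_sumE.
exact: is_derive_sum.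
Qed.

Lemma is_derive_mul (f g : R -> R) (t df dg : R) : is_derive t 1 f df ->
  is_derive t 1 g dg -> is_derive t 1 (fun s => f s * g s) (df * g t + f t * dg).
Proof.
move=> hf hg; apply: is_derive_eq (is_deriveM hf hg) _.
by rewrite /GRing.scale/=; ring.
Qed.

Lemma is_derive_curve2 (E : 'rV[R]_3 -> R) (c dc : R -> 'rV[R]_3) (ddc : 'rV[R]_3) t :
  (forall i, differentiable (partial i E) (c t)) ->
  (forall i, is_derive t 1 (fun s => c s 0 i) (dc t 0 i)) ->
  (forall i, is_derive t 1 (fun s => dc s 0 i) (ddc 0 i)) ->
  is_derive t 1 (fun s => \sum_(i < 3) partial i E (c s) * dc s 0 i)
    (\sum_(i < 3) ((\sum_(j < 3) partial j (partial i E) (c t) * dc t 0 j) * dc t 0 i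
       + partial i E (c t) * ddc 0 i)).
Proof.
move=> dE hc hdc; apply: is_derive_sum_fun => i.
exact: (@is_derive_mul (fun s => partial i E (c s)) (fun s => dc s 0 i) t _ _
  (is_derive_curve (dE i) hc) (hdc i)).
Qed.

(** The algebra behind [laplace_beltramiE], with [p] the gradient and [H] the
    Hessian of a function at [sph r th ph]. The unit vectors along [sph],
    [sph_th] and [sph_ph] are orthonormal, so the diagonal values of [H] on them
    add up to its trace; the two hypotheses are Euler's identities for degree
    zero, which kill the radial value of [H] and the first-order terms, whose
    sum is radial. *)
Lemma spherical_frame_trace (p : 'I_3 -> R) (H : 'I_3 -> 'I_3 -> R) r th ph :
  sin th != 0 ->
  \sum_(i < 3) p i * sph r th ph 0 i = 0 ->
  \sum_(i < 3) (\sum_(j < 3) H i j * sph r th ph 0 j) * sph r th ph 0 i = 0 ->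
  (sin th)^-1 *
    (cos th * \sum_(i < 3) p i * sph_th r th ph 0 i +
     sin th * \sum_(i < 3) ((\sum_(j < 3) H i j * sph_th r th ph 0 j) *
       sph_th r th ph 0 i + p i * (- sph r th ph) 0 i)) +
  sin th ^- 2 * \sum_(i < 3) ((\sum_(j < 3) H i j * sph_ph r th ph 0 j) *
      sph_ph r th ph 0 i + p i * sph_phph r th ph 0 i) =
  r ^+ 2 * \sum_(i < 3) H i i.
Proof.
have N (v : 'rV[R]_3) i : (- v) 0 i = - v 0 i by rewrite mxE.
move=> s0; rewrite !sum3 !N /sph_th /sph_ph /sph_phph /sph !mk3E.
have cs := cos2Dsin2 th; have cs' := cos2Dsin2 ph.
move: (p 0) (p 1) (p 2%:R) => p0 p1 p2.
move: (H 0 0) (H 0 1) (H 0 2%:R) (H 1 0) (H 1 1) (H 1 2%:R)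
  (H 2%:R 0) (H 2%:R 1) (H 2%:R 2%:R) => h00 h01 h02 h10 h11 h12 h20 h21 h22.
move: (sin th) (cos th) (sin ph) (cos ph) s0 cs cs' => a b d c a0 cs cs'.
set U1 := (X in X = 0 -> _); set U2 := (X in _ -> X = 0 -> _) => U10 U20.
have X0 : b ^+ 2 + a ^+ 2 - 1 = 0 by rewrite cs subrr.
have Y0 : c ^+ 2 + d ^+ 2 - 1 = 0 by rewrite cs' subrr.
apply/eqP; rewrite -subr_eq0; apply/eqP.
(* The difference of the two sides as a combination of the relations
   [b ^+ 2 + a ^+ 2 = 1], [c ^+ 2 + d ^+ 2 = 1], [U1 = 0] and [U2 = 0]. *)
transitivity ((b ^+ 2 + a ^+ 2 - 1) * (r * (p0 * c + p1 * d) / a) - 2 * U1 - U2 +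
  r ^+ 2 * ((b ^+ 2 + a ^+ 2 - 1) *
    (h00 * c ^+ 2 + (h01 + h10) * c * d + h11 * d ^+ 2 + h22) +
    (c ^+ 2 + d ^+ 2 - 1) * (h00 + h11))).
  by rewrite /U1 /U2; field.
by rewrite X0 Y0 U10 U20; ring.
Qed.

Variable f : 'rV[R]_3 -> R.
Hypothesis f2 : C2_sphere f.
Let E y := f ((enorm y)^-1 *: y).

Let E1 y : y != 0 -> differentiable E y.
Proof. by move=> y0; case: f2 => /(_ y y0)[]. Qed.

Let E2 y i : y != 0 -> differentiable (partial i E) y.
Proof. by move=> y0; case: f2 => _ /(_ i y y0)[]. Qed.

Let E_sph r th ph : 0 < r -> f (sph 1 th ph) = E (sph r th ph).
Proof. by move=> r0; rewrite /E enorm_sph gtr0_norm// sphZ mulVf// gt_eqF. Qed.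

Let E_scale (s : R) y : 0 < s -> E (s *: y) = E y.
Proof.
move=> s0; rewrite /E enormZ gtr0_norm// scalerA invfM mulrAC mulVf ?gt_eqF//.
by rewrite mul1r.
Qed.

(** Euler's identities for a function of degree zero, that is, constant along
    rays. *)
Let E_euler1 y : y != 0 -> \sum_(i < 3) partial i E y * y 0 i = 0.
Proof.
move=> y0.
have c i : is_derive (1:R) 1 (fun s : R => (s *: y) 0 i) (y 0 i).
  have -> : (fun s : R => (s *: y) 0 i) = (fun s => s * y 0 i).
    by apply/funext => s; rewrite mxE.
  by apply: is_derive_eq; rewrite /GRing.scale/=; ring.
have d : differentiable E ((fun s : R => s *: y) 1) by rewrite /= scale1r; exact: E1.
have /is_derive1E h := @is_derive_curve R E (fun s => s *: y) y 1 d c.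
rewrite /= scale1r in h; rewrite -h derive1E.
rewrite (@near_eq_derive _ _ _ _ (cst (E y)) (1 : R) 1) ?derive_cst//.
have p : \forall s \near (1 : R), 0 < s by exact: lt_nbhsr.
by apply: filterS p => s s0; rewrite E_scale.
Qed.

Let E_euler2 y : y != 0 ->
  \sum_(i < 3) (\sum_(j < 3) partial j (partial i E) y * y 0 j) * y 0 i = 0.
Proof.
move=> y0.
have c (t : R) i : is_derive t 1 (fun s : R => (s *: y) 0 i) (y 0 i).
  have -> : (fun s : R => (s *: y) 0 i) = (fun s => s * y 0 i).
    by apply/funext => s; rewrite mxE.
  by apply: is_derive_eq; rewrite /GRing.scale/=; ring.
have cc (t : R) i : is_derive t 1 (fun s : R => y 0 i) ((0 : 'rV[R]_3) 0 i).
  by rewrite mxE; exact: is_derive_cst.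
have d i : differentiable (partial i E) ((fun s : R => s *: y) 1).
  by rewrite /= scale1r; exact: E2.
have /is_derive1E h := @is_derive_curve2 E (fun s => s *: y) (fun=> y) 0 1 d (c 1) (cc 1).
rewrite /= scale1r in h.
transitivity (\sum_(i < 3)
        ((\sum_(j < 3) partial j (partial i E) y * y 0 j) * y 0 i +
         partial i E y * (0 : 'rV[R]_3) 0 i)).
  by apply: eq_bigr => i _; rewrite mxE mulr0 addr0.
rewrite -h derive1E (@near_eq_derive _ _ _ _ (cst 0) (1 : R) 1) ?derive_cst//.
have p : \forall s \near (1 : R), 0 < s by exact: lt_nbhsr.
apply: filterS p => s s0 /=.
have sy0 : s *: y != 0 by rewrite scaler_eq0 negb_or y0 gt_eqF.
have := E_euler1 sy0.
rewrite (eq_bigr (fun i => s * (partial i E (s *: y) * y 0 i))); last first.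
  by move=> i _; rewrite mxE mulrCA.
by rewrite -mulr_sumr => /eqP; rewrite mulf_eq0 gt_eqF//= => /eqP.
Qed.

(** The surface Laplacian of a function is the Laplacian of its extension that
    is constant along rays. *)
Lemma laplace_beltramiE r th ph : 0 < r -> 0 < th < pi ->
  laplace_beltrami f th ph = r ^+ 2 * laplacian E (sph r th ph).
Proof.
move=> r0 thpi.
have s0 : sin th != 0 by rewrite gt_eqF// sin_gt0_pi// in_itv.
pose A (s : R) := \sum_(i < 3) partial i E (sph r s ph) * sph_th r s ph 0 i.
have e1 : (fun s => sin s * derive1 (fun s' => f (sph 1 s' ph)) s) =
    (fun s => sin s * A s).
  apply/funext => s; congr (_ * _).
  have -> : (fun s' => f (sph 1 s' ph)) = (fun s' => E (sph r s' ph)).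
    by apply/funext => s'; exact: E_sph.
  apply: is_derive1E.
  apply: (@is_derive_curve R E (fun s => sph r s ph) (sph_th r s ph)).
    exact/E1/sph_neq0.
  exact: is_derive_sph_th.
have e2 : (fun s => f (sph 1 th s)) = (fun s => E (sph r th s)).
  by apply/funext => s'; exact: E_sph.
have e3 : derive1 (fun s => E (sph r th s)) =
    (fun s => \sum_(i < 3) partial i E (sph r th s) * sph_ph r th s 0 i).
  apply/funext => s; apply: is_derive1E.
  apply: (@is_derive_curve R E (fun s => sph r th s) (sph_ph r th s)).
    exact/E1/sph_neq0.
  exact: is_derive_sph_ph.
rewrite /laplace_beltrami e1 e2 derive1nS derive1n1 e3.
have y0 := sph_neq0 th ph r0.
have d1 := @is_derive_curve2 E (fun s => sph r s ph) (fun s => sph_th r s ph)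
  (- sph r th ph) th (fun i => E2 i y0) (is_derive_sph_th r th ph).
have d2 := @is_derive_curve2 E (fun s => sph r th s) (fun s => sph_ph r th s)
  (sph_phph r th ph) ph (fun i => E2 i y0) (is_derive_sph_ph r th ph)
  (is_derive_sph_phph r th ph).
rewrite (is_derive1E d2) {d2}.
have {}d1 : is_derive th 1 A _ := d1 _.
have h i : is_derive th 1 (fun s => sph_th r s ph 0 i) ((- sph r th ph) 0 i).
  by rewrite mxE; exact: is_derive_sph_thth.
rewrite (is_derive1E (is_derive_mul (is_derive_sin th) (d1 h))) /A.
clear d1 h e1 e2 e3 A.
have u1 := E_euler1 y0; have u2 := E_euler2 y0.
exact: (@spherical_frame_trace (fun i => partial i E (sph r th ph))
  (fun i j => partial j (partial i E) (sph r th ph)) r th ph s0 u1 u2).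
Qed.

Variable k : R.
Hypothesis f_eq : forall th ph, 0 < th < pi ->
  2 * f (sph 1 th ph) + laplace_beltrami f th ph = k.

Let lapE_continuous y : y != 0 -> {for y, continuous (laplacian E)}.
Proof.
move=> y0; have -> : laplacian E =
    (fun z => partial 0 (partial 0 E) z + partial 1 (partial 1 E) z +
              partial 2%:R (partial 2%:R E) z).
  by apply/funext => z; rewrite /laplacian sum3.
have c i : {for y, continuous (partial i (partial i E))}.
  by case: f2 => _ /(_ i y y0)[_]; apply.
exact: (continuousD (continuousD (c 0) (c 1)) (c 2%:R)).
Qed.

(** The polar axis is outside the chart; it is reached by continuity. *)
Let E_eq y : y != 0 -> 2 * E y + enorm y ^+ 2 * laplacian E y = k.
Proof.
move=> y0; have [th [ph [thpi yE]]] := sph_surj y.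
have n0 : 0 < enorm y by rewrite enorm_gt0.
pose r := enorm y.
pose q (s : R) := 2 * E (sph r s ph) + r ^+ 2 * laplacian E (sph r s ph).
have qk s : 0 < s < pi -> q s = k.
  by move=> sp; rewrite /q -laplace_beltramiE// -E_sph// f_eq.
have qc : continuous q.
  move=> s; have z0 := sph_neq0 s ph n0.
  have cs := @sph_continuous_th R r ph s.
  have c1 : {for s, continuous (fun s => E (sph r s ph))}.
    exact: (continuous_comp cs (differentiable_continuous (E1 z0))).
  have c2 : {for s, continuous (fun s => laplacian E (sph r s ph))}.
    exact: (continuous_comp cs (lapE_continuous z0)).
  exact: (continuousD (continuousM (cvg_cst (2:R)) c1)
    (continuousM (cvg_cst (r ^+ 2 : R)) c2)).
suff : q th = k by rewrite /q -yE.
have [t0|t0] := eqVneq th 0.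
  have h1 : q s @[s --> (0:R)^'+] --> q 0 by apply: cvg_at_right_filter; exact: qc.
  have h2 : q s @[s --> (0:R)^'+] --> k.
    apply: cvg_near_cst; near=> s; apply: qk.
    by apply/andP; split; near: s; [exact: nbhs_right_gt|
      apply: nbhs_right_lt; exact: pi_gt0].
  by rewrite t0; apply: (cvg_unique _ h1 h2).
have [tp|tp] := eqVneq th pi.
  have h1 : q s @[s --> (pi:R)^'-] --> q pi by apply: cvg_at_left_filter; exact: qc.
  have h2 : q s @[s --> (pi:R)^'-] --> k.
    apply: cvg_near_cst; near=> s; apply: qk.
    by apply/andP; split; near: s; [apply: nbhs_left_gt; exact: pi_gt0|
      exact: nbhs_left_lt].
  by rewrite tp; apply: (cvg_unique _ h1 h2).
by apply: qk; rewrite !lt_neqAle eq_sym t0 tp.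
Unshelve. all: by end_near. Qed.

(** The shift by [k / 2] makes the equation homogeneous and the factor [enorm y]
    gives the degree [l] with [l (l + 1) = 2]; for such a degree, an
    eigenfunction extends to a harmonic function. *)
Let F y := enorm y * (E y - k / 2).

Let dF i y := y 0 i / enorm y * (E y - k / 2) + enorm y * partial i E y.

Let F_derive y i : y != 0 -> is_derive y (delta_mx 0 i) F (dF i y).
Proof.
move=> y0; have h1 := is_derive_enorm i y0.
have h2 := is_derive_partial i (E1 y0).
have h3 : is_derive y (delta_mx 0 i) (fun z => E z - k / 2) (partial i E y).
  by apply: is_derive_eq; rewrite subr0.
apply: is_derive_eq (is_deriveM h1 h3) _.
by rewrite /dF /GRing.scale/=; ring.
Qed.

Let F_hom (s : R) y : 0 < s -> F (s *: y) = s * F y.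
Proof. by move=> s0; rewrite /F E_scale// enormZ gtr0_norm// mulrA. Qed.

Let F_C1 : C1_on [set y | y != 0] F.
Proof.
move=> y /= y0; split.
  apply: differentiableM; first exact: enorm_differentiable.
  by apply: differentiableB => //; exact: E1.
move=> i; apply: (@continuous_near_eq _ (dF i)).
  have : \near y, y != 0 by apply: open_nbhs_nbhs; split => //; exact: open_neq0.
  by apply: filterS => z z0; rewrite /partial; apply/esym/derive_val/F_derive.
have n0 : enorm y != 0 by rewrite enorm_eq0.
have cn := @enorm_continuous R y.
have cp : {for y, continuous (partial i E)}.
  exact: differentiable_continuous (E2 i y0).
have cy : {for y, continuous (fun z : 'rV[R]_3 => z 0 i)}.
  exact: coord_continuous.
have c1 : {for y, continuous (fun z : 'rV[R]_3 => z 0 i / enorm z)}.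
  exact: (continuousM cy (continuousV n0 cn)).
have c2 : {for y, continuous (fun z => E z - k / 2)}.
  apply: differentiable_continuous; apply: differentiableB => //; exact: E1.
exact: (continuousD (continuousM c1 c2) (continuousM cn cp)).
Qed.

Let F_harm : harmonic_on [set y | y != 0] F.
Proof.
split.
  by move=> y /F_C1[dFy _]; exact: differentiable_continuous.
exists dF, (fun i y => ((enorm y)^-1 - y 0 i ^+ 2 * (enorm y)^-1 ^+ 3) * (E y - k / 2)
  + 2 / enorm y * (partial i E y * y 0 i) + enorm y * partial i (partial i E) y).
move=> y /= y0; have n0 : enorm y != 0 by rewrite enorm_eq0.
split; last first.
  rewrite !big_split/= -!mulr_suml -!mulr_sumr E_euler1// mulr0 addr0 sumrB.
  rewrite -mulr_suml -sqr_enorm sumr_const card_ord -mulr_natr.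
  have := E_eq y0; rewrite /laplacian => <-.
  by field.
move=> i; split; first exact: F_derive.
have h1 := is_derive_enorm i y0.
have h2 := is_derive_partial i (E1 y0).
have h3 : is_derive y (delta_mx 0 i) (fun z => E z - k / 2) (partial i E y).
  by apply: is_derive_eq; rewrite subr0.
have h4 : is_derive y (delta_mx 0 i) (fun z : 'rV[R]_3 => z 0 i) 1.
  by have := is_derive_coord y (delta_mx 0 i) i; rewrite mxE !eqxx.
have h5 := is_deriveV_fun n0 h1.
have h6 := is_derive_partial i (E2 i y0).
apply: is_derive_eq (is_deriveD (is_deriveM (is_deriveM h4 h5) h3) (is_deriveM h1 h6)) _.
by rewrite /GRing.scale/= mulrfctE; field.
Qed.

Lemma laplace_beltrami_eigen2 : exists a : 'I_3 -> R,
  forall w, sphere1 w -> f w = k / 2 + \sum_(i < 3) w 0 i * a i.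
Proof.
exists (fun i => F (delta_mx 0 i)) => w w1.
rewrite -(degree1_harmonic_linear F_hom F_C1 F_harm).
by rewrite /F /E w1 invr1 scale1r mul1r addrC subrK.
Qed.

End LaplaceBeltrami.

(** * Integrals over the polar angles *)

Section AngleIntegrals.
Context {R : realType}.
Let leb := @lebesgue_measure R.

Lemma integral_FTC2 (a A : R -> R) (x y : R) : x < y -> continuous a ->
  (forall t : R, is_derive t 1 A (a t)) ->
  (\int[leb]_(t in `[x, y]) (a t)%:E = (A y - A x)%:E)%E.
Proof.
move=> xy ac dA; rewrite (@continuous_FTC2 R a A x y xy) ?EFinB//.
- exact: continuous_subspaceT.
- split.
  + by move=> t _; case: (dA t).
  + by apply: cvg_at_right_filter; apply: is_derive_continuous (dA x).
  + by apply: cvg_at_left_filter; apply: is_derive_continuous (dA y).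
- by move=> t _; exact: is_derive1E.
Qed.

Lemma measurable_angles : measurable (@angles R).
Proof. by apply: measurableX; exact: measurable_itv. Qed.

Lemma integrable_angles (a b : R -> R) : continuous a -> continuous b ->
  (leb \x leb)%E.-integrable angles (EFin \o (fun z => a z.1 * b z.2)).
Proof.
move=> ac bc; apply: measurable_bounded_integrable.
- exact: measurable_angles.
- change ((leb \x leb)%E (@angles R) < +oo)%E.
  have -> : (leb \x leb)%E angles = (leb `[0%R, pi] * leb `[0%R, (2 * pi)%R])%E.
    by apply: product_measure1E; exact: measurable_itv.
  by rewrite /leb !lebesgue_measure_itv/= !lte_fin; do 2!case: ifP => _;
    rewrite ?mule0 ?mul0e// -!EFinB -EFinM ltry.
- apply: measurable_realfun.measurable_funM.
    apply: measurable_funS measurableT _ _ => //.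
    exact: (measurableT_comp (measurable_realfun.continuous_measurable_fun ac) measurable_fst).
  apply: measurable_funS measurableT _ _ => //.
  exact: (measurableT_comp (measurable_realfun.continuous_measurable_fun bc) measurable_snd).
- have bd (c : R -> R) (x y : R) : continuous c ->
      exists2 M, 0 < M & forall t, t \in `[x, y] -> `|c t| <= M.
    move=> cc; have /ex_strict_bound_gt0[M M0 hM] : bounded_set (c @` `[x, y]).
      apply/compact_bounded/continuous_compact; last exact: segment_compact.
      exact: continuous_subspaceT.
    by exists M => // t txy; apply/ltW/hM; exists t.
  have [M M0 hM] := bd a 0 pi ac; have [N N0 hN] := bd b 0 (2 * pi) bc.
  exists (M * N); split; first exact: num_real.
  move=> x Mx [s t] [/= s1 t1]; apply: le_trans (ltW Mx).
  by rewrite normrM ler_pM// ?hM ?hN.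
Qed.

(** Fubini, then the fundamental theorem of calculus in each variable. *)
Lemma Rintegral_angles (a b A B : R -> R) : continuous a -> continuous b ->
  (forall t : R, is_derive t 1 A (a t)) -> (forall t : R, is_derive t 1 B (b t)) ->
  Rintegral (leb \x leb)%E angles (fun z => a z.1 * b z.2) =
    (A pi - A 0) * (B (2 * pi) - B 0).
Proof.
move=> ac bc dA dB; have iab := integrable_angles ac bc.
have pi0 : (0 : R) < pi := pi_gt0 R.
have mang := measurable_angles.
rewrite /Rintegral integral_mkcond -integral12_prod_meas1; last first.
  by apply/integrable_restrict => //; rewrite setTI.
pose K := B (2 * pi) - B 0.
rewrite (_ : (fun x => _) = (EFin \o (fun x : R => a x * K)) \_ `[0, pi]); last first.
  apply/funext => x.
  have [x0|x0] := boolP (x \in `[0, pi]%classic); last first.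
    rewrite patchE (negPf x0); apply: integral0_eq => y _.
    rewrite patchE ifF//; apply/negP => /[!inE] -[/= x1 _].
    by move: x0; rewrite notin_setE.
  rewrite patchE x0.
  transitivity (\int[leb]_(y in `[0%R, (2 * pi)%R]) (a x * b y)%:E)%E.
    rewrite [RHS]integral_mkcond; apply: eq_integral => y _.
    rewrite !patchE/=; congr (if _ then _ else _).
    apply/idP/idP; rewrite !inE; first by case.
    by move=> y1; split => //; move: x0; rewrite inE.
  rewrite (@integral_FTC2 (fun y => a x * b y) (fun y => a x * B y)).
  - by rewrite -mulrBr.
  - by rewrite mulr_gt0.
  - by move=> y; apply: continuousM; [exact: cvg_cst|exact: bc].
have dK (t : R) : is_derive t 1 (fun x => A x * K) (a t * K).
  have -> : (fun x => A x * K) = (fun x => K * A x).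
    by apply/funext => x; rewrite mulrC.
  by rewrite mulrC; exact: is_deriveZ.
rewrite -integral_mkcond (@integral_FTC2 (fun x => a x * K) (fun x => A x * K))//=.
  by rewrite -mulrBl.
by move=> x; exact: (continuousM (ac x) (cvg_cst K)).
Qed.

End AngleIntegrals.

(** * The centroid condition *)

Lemma Rintegral_lin4 (R : realType) d (T : measurableType d)
    (mu : {measure set T -> \bar R}) (D : set T) (f0 f1 f2 f3 : T -> R)
    (k c0 c1 c2 c3 : R) : measurable D ->
  mu.-integrable D (EFin \o f0) -> mu.-integrable D (EFin \o f1) ->
  mu.-integrable D (EFin \o f2) -> mu.-integrable D (EFin \o f3) ->
  Rintegral mu D (fun z => k * (c0 * f0 z + c1 * f1 z + c2 * f2 z + c3 * f3 z)) =
  k * (c0 * Rintegral mu D f0 + c1 * Rintegral mu D f1 +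
       c2 * Rintegral mu D f2 + c3 * Rintegral mu D f3).
Proof.
move=> mA i0 i1 i2 i3.
have Z (c : R) f : mu.-integrable D (EFin \o f) ->
    mu.-integrable D (EFin \o (fun z => c * f z)).
  move=> fi; have := integrableZl mA c fi.
  by apply: eq_integrable.
have A f g : mu.-integrable D (EFin \o f) -> mu.-integrable D (EFin \o g) ->
    mu.-integrable D (EFin \o (fun z => f z + g z)).
  by move=> fi gi; have := integrableD mA fi gi; apply: eq_integrable.
rewrite RintegralZl//; last by do 3![apply: (A); last exact: Z]; exact: Z.
rewrite RintegralD//; [|by do 2![apply: (A); last exact: Z]; exact: Z|exact: Z].
rewrite RintegralD//; [|by apply: (A); exact: Z|exact: Z].
rewrite RintegralD//; [|exact: Z|exact: Z].
by rewrite !RintegralZl.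
Qed.

Section Centroid.
Context {R : realType}.
Let leb := @lebesgue_measure R.

Let I (a b : R -> R) : R :=
  Rintegral (leb \x leb)%E angles (fun z => a z.1 * b z.2).

Let cM (a b : R -> R) : continuous a -> continuous b ->
  continuous (fun t => a t * b t).
Proof. by move=> ca cb t; exact: (continuousM (ca t) (cb t)). Qed.

Let cs : continuous (@sin R). Proof. exact: continuous_sin. Qed.
Let cc : continuous (@cos R). Proof. exact: continuous_cos. Qed.

(** The inner product of [c0] plus a linear form with a harmonic whose variables
    separate reduces to four products of one-dimensional integrals. *)
Lemma Rintegral_angles_comb (T P : R -> R) (k c0 c1 c2 c3 : R) :
  continuous T -> continuous P ->
  Rintegral (leb \x leb)%E angles (fun z =>
    (c0 + (sin z.1 * cos z.2 * c1 + sin z.1 * sin z.2 * c2 + cos z.1 * c3)) *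
    (k * (T z.1 * P z.2)) * sin z.1) =
  k * (c0 * I (fun t => T t * sin t) P +
       c1 * I (fun t => T t * sin t * sin t) (fun t => P t * cos t) +
       c2 * I (fun t => T t * sin t * sin t) (fun t => P t * sin t) +
       c3 * I (fun t => T t * sin t * cos t) P).
Proof.
move=> cT cP.
transitivity (Rintegral (leb \x leb)%E angles (fun z => k *
    (c0 * (T z.1 * sin z.1 * P z.2) +
     c1 * (T z.1 * sin z.1 * sin z.1 * (P z.2 * cos z.2)) +
     c2 * (T z.1 * sin z.1 * sin z.1 * (P z.2 * sin z.2)) +
     c3 * (T z.1 * sin z.1 * cos z.1 * P z.2)))).
  by apply: eq_Rintegral => z _ /=; ring.
apply: Rintegral_lin4; first exact: measurable_angles.
- exact: (integrable_angles (cM cT cs) cP).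
- exact: (integrable_angles (cM (cM cT cs) cs) (cM cP cc)).
- exact: (integrable_angles (cM (cM cT cs) cs) (cM cP cs)).
- exact: (integrable_angles (cM (cM cT cs) cc) cP).
Qed.

Let IE (a b A B : R -> R) : continuous a -> continuous b ->
  (forall t : R, is_derive t 1 A (a t)) -> (forall t : R, is_derive t 1 B (b t)) ->
  I a b = (A pi - A 0) * (B (2 * pi) - B 0).
Proof. exact: Rintegral_angles. Qed.

Let sin_2pi : sin (2 * pi) = 0 :> R.
Proof. by rewrite mulr_natl sin2pi. Qed.

Let cos_2pi : cos (2 * pi) = 1 :> R.
Proof. by rewrite mulr_natl cos2pi. Qed.

Let trigE := (sin_2pi, cos_2pi, @sin0 R, @cos0 R, @sinpi R, @cospi R).

Let c1 : continuous (fun _ : R => 1 : R). Proof. by move=> t; exact: cvg_cst. Qed.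

Let d_id (t : R) : is_derive t 1 (fun s => s) (1 : R).
Proof. exact: is_derive_id. Qed.

Let d_sin2 (t : R) : is_derive t 1 (fun s => sin s ^+ 2 / 2) (cos t * sin t).
Proof. by apply: is_derive_eq; rewrite /GRing.scale/=; field. Qed.

Let d_sin2' (t : R) : is_derive t 1 (fun s => sin s ^+ 2 / 2) (sin t * cos t).
Proof. by apply: is_derive_eq; rewrite /GRing.scale/=; field. Qed.

Let coef_eq0 (N b x : R) : N != 0 -> b != 0 -> N * (x * b) = 0 -> x = 0.
Proof.
move=> N0 b0 /eqP; rewrite !mulf_eq0 (negPf N0) (negPf b0) orbF /=.
by move/eqP.
Qed.

Let d_sin3 (t : R) : is_derive t 1 (fun s => sin s ^+ 3 / 3) (sin t * sin t * cos t).
Proof. by apply: is_derive_eq; rewrite /GRing.scale/=; field. Qed.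

Let d_sin3' (t : R) : is_derive t 1 (fun s => sin s ^+ 3 / 3) (cos t * sin t * sin t).
Proof. by apply: is_derive_eq; rewrite /GRing.scale/=; field. Qed.

Let d_cos3 (t : R) : is_derive t 1 (fun s => - cos s ^+ 3 / 3) (cos t * sin t * cos t).
Proof. by apply: is_derive_eq; rewrite /GRing.scale/=; field. Qed.

Let d_sinsin (t : R) : is_derive t 1 (fun s => (s - sin s * cos s) / 2) (sin t * sin t).
Proof.
apply: is_derive_eq; rewrite /GRing.scale/=; have := cos2Dsin2 t; lra.
Qed.

Let d_coscos (t : R) : is_derive t 1 (fun s => (s + sin s * cos s) / 2) (cos t * cos t).
Proof.
apply: is_derive_eq; rewrite /GRing.scale/=; have := cos2Dsin2 t; lra.
Qed.

Let d_sinsinsin (t : R) :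
  is_derive t 1 (fun s => cos s ^+ 3 / 3 - cos s) (sin t * sin t * sin t).
Proof.
apply: is_derive_eq; rewrite /GRing.scale/=.
have s2 : sin t * sin t = 1 - cos t ^+ 2 by have := cos2Dsin2 t; lra.
by rewrite s2; field.
Qed.

Let d_sin (t : R) : is_derive t 1 (fun s => - cos s) (sin t).
Proof. by apply: is_derive_eq; rewrite opprK. Qed.

Let d_mul1 (A : R -> R) (a : R -> R) (t : R) : is_derive t 1 A (a t) ->
  is_derive t 1 A (1 * a t).
Proof. by rewrite mul1r. Qed.

Let legendre1 : legendre 1 = 'X :> {poly R}.
Proof.
rewrite /legendre expr1 derivn1 derivB derivXn derivC subr0 expr1.
have -> : 'X *+ 2 = (2 : R) *: 'X :> {poly R} by rewrite scaler_nat.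
by rewrite scalerA mulVf ?scale1r ?pnatr_eq0.
Qed.

Lemma sphY10 : exists2 N : R, N != 0 & sphY 1 0 = fun th ph => N * (cos th * 1).
Proof.
eexists; last first.
  apply/funext => th; apply/funext => ph.
  by rewrite /sphY legendre1 [absz _]/= derivn0 hornerX expr0 mul1r -mulrA.
by rewrite sqrtr_eq0 -ltNge !mulr_gt0 ?invr_gt0 ?mulr_gt0 ?ltr0n ?fact_gt0 ?pi_gt0.
Qed.

Lemma sphY11 : exists2 N : R, N != 0 & sphY 1 1 = fun th ph => N * (sin th * cos ph).
Proof.
eexists; last first.
  apply/funext => th; apply/funext => ph.
  rewrite /sphY legendre1 [absz _]/= derivn1 derivX hornerC expr1 mulr1 !mul1r.
  by rewrite mulrACA.
rewrite mulf_neq0 // sqrtr_eq0 -ltNge ?ltr0n//.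
by rewrite !mulr_gt0 ?invr_gt0 ?mulr_gt0 ?ltr0n ?fact_gt0 ?pi_gt0.
Qed.

Lemma sphY1N1 : exists2 N : R, N != 0 & sphY 1 (-1) = fun th ph => N * (sin th * sin ph).
Proof.
eexists; last first.
  apply/funext => th; apply/funext => ph.
  rewrite /sphY legendre1 [absz _]/= derivn1 derivX hornerC expr1 mulr1 !mul1r.
  by rewrite mulrACA.
rewrite mulf_neq0 // sqrtr_eq0 -ltNge ?ltr0n//.
by rewrite !mulr_gt0 ?invr_gt0 ?mulr_gt0 ?ltr0n ?fact_gt0 ?pi_gt0.
Qed.

(** Constants and the coordinates other than its own are orthogonal to each
    harmonic of degree one, so each of the three conditions isolates one
    coefficient. *)
Lemma centroid_linear_eq0 (f : 'rV[R]_3 -> R) (k : R) (a : 'I_3 -> R) :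
  (forall w, sphere1 w -> f w = k + \sum_(i < 3) w 0 i * a i) ->
  (forall m : int, m \in [:: -1; 0; 1] -> inner_L2S f (sphY 1 m) = 0) ->
  forall i, a i = 0.
Proof.
move=> fE fY.
have pin0 : pi != 0 :> R by rewrite gt_eqF// pi_gt0.
have inner (N : R) (T P : R -> R) : continuous T -> continuous P ->
    inner_L2S f (fun th ph => N * (T th * P ph)) =
    N * (k * I (fun t => T t * sin t) P +
       a 0 * I (fun t => T t * sin t * sin t) (fun t => P t * cos t) +
       a 1 * I (fun t => T t * sin t * sin t) (fun t => P t * sin t) +
       a 2%:R * I (fun t => T t * sin t * cos t) P).
  move=> cT cP; rewrite -Rintegral_angles_comb//; apply: eq_Rintegral => z _.
  congr (_ * _ * _); rewrite fE; last by rewrite /sphere1/= enorm_sph normr1.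
  by rewrite sum3 /sph !mk3E !mul1r.
apply: ord3P.
- have [N N0 E] := sphY11.
  have := fY 1 isT; rewrite E inner//.
  rewrite (IE (cM cs cs) cc d_sinsin (@is_derive_sin R)).
  rewrite (IE (cM (cM cs cs) cs) (cM cc cc) d_sinsinsin d_coscos).
  rewrite (IE (cM (cM cs cs) cs) (cM cc cs) d_sinsinsin d_sin2).
  rewrite (IE (cM (cM cs cs) cc) cc d_sin3 (@is_derive_sin R)) !trigE.
  move=> H; apply: (@coef_eq0 N (4 / 3 * pi)) => //; first by rewrite mulf_neq0.
  by rewrite -[RHS]H; field.
- have [N N0 E] := sphY1N1.
  have := fY (-1) isT; rewrite E inner//.
  rewrite (IE (cM cs cs) cs d_sinsin d_sin).
  rewrite (IE (cM (cM cs cs) cs) (cM cs cc) d_sinsinsin d_sin2').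
  rewrite (IE (cM (cM cs cs) cs) (cM cs cs) d_sinsinsin d_sinsin).
  rewrite (IE (cM (cM cs cs) cc) cs d_sin3 d_sin) !trigE.
  move=> H; apply: (@coef_eq0 N (4 / 3 * pi)) => //; first by rewrite mulf_neq0.
  by rewrite -[RHS]H; field.
- have [N N0 E] := sphY10.
  have := fY 0 isT; rewrite E (inner N (@cos R) (fun=> 1))//.
  rewrite (IE (cM cc cs) c1 d_sin2 d_id).
  rewrite (IE (cM (cM cc cs) cs) (cM c1 cc) d_sin3' (fun t => d_mul1 (is_derive_sin t))).
  rewrite (IE (cM (cM cc cs) cs) (cM c1 cs) d_sin3' (fun t => d_mul1 (d_sin t))).
  rewrite (IE (cM (cM cc cs) cc) c1 d_cos3 d_id) !trigE.
  move=> H; apply: (@coef_eq0 N (4 / 3 * pi)) => //; first by rewrite mulf_neq0.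
  by rewrite -[RHS]H; field.
Qed.

End Centroid.

(** * Limits at the unit sphere *)

(** Limits along a filter restricted to [D] compose with other limits, whereas
    the subspace topology of [{within D, continuous f}] does not. *)
Lemma within_continuousP (T U : topologicalType) (D : set T) (f : T -> U) :
  {within D, continuous f} <->
  forall w, D w -> f y @[y --> within D (nbhs w)] --> f w.
Proof.
split=> [fc w Dw|fc]; first by rewrite (nbhs_subspace_in Dw); exact: fc.
rewrite continuous_subspace_in => w /set_mem Dw.
by have := fc w Dw; rewrite (nbhs_subspace_in Dw).
Qed.

Lemma continuous_within_precomp (T U V : topologicalType) (A : set T) (D : set U)
    (g : T -> U) (f : U -> V) : (forall x, A x -> D (g x)) -> continuous g ->
  {within D, continuous f} -> {within A, continuous (fun x => f (g x))}.
Proof.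
move=> AD gc /within_continuousP fc; apply/within_continuousP => x Ax B hB.
have h1 : \forall y \near g x, D y -> B (f y) := fc (g x) (AD x Ax) B hB.
have h2 : \forall z \near x, D (g z) -> B (f (g z)) := gc x _ h1.
suff : \forall z \near x, A z -> B (f (g z)) by [].
by apply: filterS h2 => z h /AD; exact: h.
Qed.

Section Traces.
Context {R : realType}.
Implicit Types (r th ph : R) (y w : 'rV[R]_3).

Lemma cvg_sum3 T (F : set_system T) {FF : Filter F} (f : 'I_3 -> T -> R) (l : 'I_3 -> R) :
  (forall i, f i x @[x --> F] --> l i) ->
  (\sum_(i < 3) f i x) @[x --> F] --> \sum_(i < 3) l i.
Proof.
move=> fl; rewrite sum3; under eq_fun do rewrite sum3.
exact: (cvgD (cvgD (fl 0) (fl 1)) (fl 2%:R)).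
Qed.

Lemma cvg_row T (F : set_system T) {FF : Filter F} (f : T -> 'rV[R]_3) w :
  (forall i, f x 0 i @[x --> F] --> w 0 i) -> f x @[x --> F] --> w.
Proof.
move=> fw; apply/cvgrPdist_le => e e0.
have H : \forall x \near F, forall i : 'I_3, `|w 0 i - f x 0 i| <= e.
  apply: filter_forall => i.
  by have /cvgrPdist_le/(_ e e0) := fw i.
apply: filterS H => x H; rewrite [leLHS]mx_normrE.
apply: bigmax_le; first exact: ltW.
by move=> [i j] _ /=; rewrite (ord1 i) !mxE.
Qed.

Lemma cvg_sph T (F : set_system T) {FF : Filter F} (rr ss : T -> R) r th ph :
  rr x @[x --> F] --> r -> ss x @[x --> F] --> th ->
  sph (rr x) (ss x) ph @[x --> F] --> sph r th ph.
Proof.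
move=> hr hs.
have cs := cvg_comp _ _ hs (@continuous_sin R th).
have cc := cvg_comp _ _ hs (@continuous_cos R th).
apply: cvg_row; elim/ord3P; rewrite /sph !mk3E; under eq_fun do rewrite !mk3E.
- exact: (cvgM (cvgM hr cs) (cvg_cst _)).
- exact: (cvgM (cvgM hr cs) (cvg_cst _)).
- exact: (cvgM hr cc).
Qed.

Lemma cvg_sph_th T (F : set_system T) {FF : Filter F} (rr ss : T -> R) r th ph i :
  rr x @[x --> F] --> r -> ss x @[x --> F] --> th ->
  sph_th (rr x) (ss x) ph 0 i @[x --> F] --> sph_th r th ph 0 i.
Proof.
move=> hr hs.
have cs := cvg_comp _ _ hs (@continuous_sin R th).
have cc := cvg_comp _ _ hs (@continuous_cos R th).
elim/ord3P : i; rewrite /sph_th !mk3E; under eq_fun do rewrite !mk3E.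
- exact: (cvgM (cvgM hr cc) (cvg_cst _)).
- exact: (cvgM (cvgM hr cc) (cvg_cst _)).
- exact: (cvgM (cvgN hr) cs).
Qed.

Lemma cvg_sph_ext T (F : set_system T) {FF : Filter F} (rr ss : T -> R) th ph :
  rr x @[x --> F] --> 1^'+ -> ss x @[x --> F] --> th ->
  sph (rr x) (ss x) ph @[x --> F] --> within (@ext1 R) (nbhs (sph 1 th ph)).
Proof.
move=> hr hs A /= wA.
have hr1 : rr x @[x --> F] --> (1 : R) by apply: cvg_trans hr _; exact: cvg_within.
have h1 : \forall x \near F, ext1 (sph (rr x) (ss x) ph) -> A (sph (rr x) (ss x) ph).
  exact: (cvg_sph hr1 hs wA).
have h2 : \forall x \near F, 1 < rr x := hr _ (nbhs_right_gt 1).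
move: h1 h2; apply: filterS2 => x /= h1 h2; apply: h1.
by rewrite /ext1/= enorm_sph gtr0_norm// (lt_trans ltr01).
Qed.

End Traces.

(** * Radial symmetry of the exterior potential *)

Section Exterior.
Context {R : realType}.
Implicit Types (r th ph : R) (y w : 'rV[R]_3).
Variable Phi : 'rV[R]_3 -> R.
Hypothesis Phi_C2 : C2_upto (@ext1 R) Phi.

Let D1 y : ext1 y -> differentiable Phi y.
Proof. by move=> y1; case: Phi_C2 => -[/(_ y y1)[]]. Qed.

Let D2 i y : ext1 y -> differentiable (partial i Phi) y.
Proof. by move=> y1; case: Phi_C2 => -[_ /(_ i y y1)[]]. Qed.

Let Phi_within : {within @ext1 R `|` @sphere1 R, continuous Phi}.
Proof. by case: Phi_C2 => _ []. Qed.

Let G i w : R := lim (partial i Phi y @[y --> within (@ext1 R) (nbhs w)]).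
Let H i j w : R :=
  lim (partial j (partial i Phi) y @[y --> within (@ext1 R) (nbhs w)]).

Let G_cvg i w : sphere1 w ->
  partial i Phi y @[y --> within (@ext1 R) (nbhs w)] --> G i w.
Proof. by move=> w1; case: Phi_C2 => _ [_ _ /(_ i w w1)]. Qed.

Let H_cvg i j w : sphere1 w ->
  partial j (partial i Phi) y @[y --> within (@ext1 R) (nbhs w)] --> H i j w.
Proof. by move=> w1; case: Phi_C2 => _ _ /(_ j i w w1). Qed.

Let sph1 th ph : sphere1 (sph 1 th ph).
Proof. by rewrite /sphere1/= enorm_sph normr1. Qed.

Let ext_sph r th ph : 1 < r -> ext1 (sph r th ph).
Proof. by move=> r1; rewrite /ext1/= enorm_sph gtr0_norm// (lt_trans ltr01). Qed.

Let r_cvg th ph :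
  sph r th ph @[r --> (1 : R)^'+] --> within (@ext1 R) (nbhs (sph 1 th ph)).
Proof. by apply: cvg_sph_ext; [exact: cvg_id|exact: cvg_cst]. Qed.

Let d_rE r th ph : 1 < r -> d_r (in_sph Phi) r th ph =
  \sum_(i < 3) partial i Phi (sph r th ph) * sph 1 th ph 0 i.
Proof.
move=> r1; apply: is_derive1E.
apply: (@is_derive_curve R Phi (fun s => sph s th ph) (sph 1 th ph)).
  exact/D1/ext_sph.
exact: is_derive_sph_r.
Qed.

Let d_thE r th ph : 1 < r -> d_th (in_sph Phi) r th ph =
  \sum_(i < 3) partial i Phi (sph r th ph) * sph_th r th ph 0 i.
Proof.
move=> r1; apply: is_derive1E.
apply: (@is_derive_curve R Phi (fun s => sph r s ph) (sph_th r th ph)).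
  exact/D1/ext_sph.
exact: is_derive_sph_th.
Qed.

Let d_thd_rE r th ph : 1 < r -> d_th (d_r (in_sph Phi)) r th ph =
  \sum_(i < 3) ((\sum_(j < 3) partial j (partial i Phi) (sph r th ph)
     * sph_th r th ph 0 j) * sph 1 th ph 0 i
     + partial i Phi (sph r th ph) * sph_th 1 th ph 0 i).
Proof.
move=> r1; rewrite /d_th.
have -> : (fun s => d_r (in_sph Phi) r s ph) = (fun s =>
    \sum_(i < 3) partial i Phi (sph r s ph) * sph 1 s ph 0 i).
  by apply/funext => s; exact: d_rE.
apply: is_derive1E; apply: is_derive_sum_fun => i.
apply: (@is_derive_mul _ (fun s => partial i Phi (sph r s ph)) (fun s => sph 1 s ph 0 i)).
  apply: (@is_derive_curve R (partial i Phi) (fun s => sph r s ph) (sph_th r th ph)).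
    exact/D2/ext_sph.
  exact: is_derive_sph_th.
exact: is_derive_sph_th.
Qed.

Let bv_extE (F : R -> R -> R -> R) (f : R -> R) th ph (l : R) :
  (forall r, 1 < r -> F r th ph = f r) -> f r @[r --> (1:R)^'+] --> l ->
  bv_ext F th ph = l.
Proof.
move=> Ff fl; apply/cvg_lim => //; apply: cvg_trans fl; apply: near_eq_cvg.
by near=> r; rewrite Ff//; near: r; exact: nbhs_right_gt.
Unshelve. all: by end_near. Qed.

(** Differentiating the moving radial direction of [d_r] in [th] produces a
    first-order term that cancels the second boundary term. What remains is the
    Hessian evaluated on the normal and on the meridian direction. *)
Let tangential_hessian th ph :
  bv_ext (d_th (d_r (in_sph Phi))) th ph - bv_ext (d_th (in_sph Phi)) th ph = 0 ->
  \sum_(i < 3) (\sum_(j < 3) H i j (sph 1 th ph) * sph_th 1 th ph 0 j)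
    * sph 1 th ph 0 i = 0.
Proof.
set w := sph 1 th ph.
have r1 : (r @[r --> (1:R)^'+] --> (1:R)) by exact: cvg_within.
have gc i : partial i Phi (sph r th ph) @[r --> (1:R)^'+] --> G i w.
  exact: (cvg_comp _ _ (@r_cvg th ph) (@G_cvg i _ (sph1 th ph))).
have hc i j : partial j (partial i Phi) (sph r th ph) @[r --> (1:R)^'+] --> H i j w.
  exact: (cvg_comp _ _ (@r_cvg th ph) (@H_cvg i j _ (sph1 th ph))).
have tc i : sph_th r th ph 0 i @[r --> (1:R)^'+] --> sph_th 1 th ph 0 i.
  by apply: cvg_sph_th; [exact: r1|exact: cvg_cst].
have l1 : bv_ext (d_th (d_r (in_sph Phi))) th ph =
    \sum_(i < 3) ((\sum_(j < 3) H i j w * sph_th 1 th ph 0 j) * w 0 i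
     + G i w * sph_th 1 th ph 0 i).
  apply: bv_extE; first by move=> r r1'; exact: d_thd_rE.
  apply: cvg_sum3 => i; apply: cvgD; apply: cvgM; [|exact: cvg_cst|exact: gc|exact: cvg_cst].
  by apply: cvg_sum3 => j; apply: cvgM; [exact: hc|exact: tc].
have l2 : bv_ext (d_th (in_sph Phi)) th ph =
    \sum_(i < 3) G i w * sph_th 1 th ph 0 i.
  apply: bv_extE; first by move=> r r1'; exact: d_thE.
  by apply: cvg_sum3 => i; apply: cvgM; [exact: gc|exact: tc].
by rewrite l1 l2 big_split/= addrK.
Qed.

Hypothesis tangential : forall th ph, 0 <= th <= pi ->
  bv_ext (d_th (d_r (in_sph Phi))) th ph - bv_ext (d_th (in_sph Phi)) th ph = 0.

Let psi y := \sum_(i < 3) partial i Phi y * y 0 i - Phi y.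

Let K ph r th := \sum_(i < 3) (\sum_(j < 3) partial j (partial i Phi) (sph r th ph)
     * sph_th r th ph 0 j) * sph r th ph 0 i.

Let psi_derive r th ph : 1 < r ->
  is_derive th 1 (fun s => psi (sph r s ph)) (K ph r th).
Proof.
move=> r1.
have h1 : is_derive th 1 (fun s => \sum_(i < 3) partial i Phi (sph r s ph) * sph r s ph 0 i)
   (\sum_(i < 3) ((\sum_(j < 3) partial j (partial i Phi) (sph r th ph)
     * sph_th r th ph 0 j) * sph r th ph 0 i
     + partial i Phi (sph r th ph) * sph_th r th ph 0 i)).
  apply: is_derive_sum_fun => i.
  apply: (@is_derive_mul _ (fun s => partial i Phi (sph r s ph)) (fun s => sph r s ph 0 i)).
    apply: (@is_derive_curve R (partial i Phi) (fun s => sph r s ph) (sph_th r th ph)).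
      exact/D2/ext_sph.
    exact: is_derive_sph_th.
  exact: is_derive_sph_th.
have h2 : is_derive th 1 (fun s => Phi (sph r s ph))
    (\sum_(i < 3) partial i Phi (sph r th ph) * sph_th r th ph 0 i).
  apply: (@is_derive_curve R Phi (fun s => sph r s ph) (sph_th r th ph)).
    exact/D1/ext_sph.
  exact: is_derive_sph_th.
apply: is_derive_eq (is_deriveB h1 h2) _.
by rewrite big_split/= addrK.
Qed.

(** The hypothesis gives this pointwise in [th]; the joint limit in [(r, th)],
    which exists because the second derivatives have traces, and compactness of
    the interval of polar angles make it uniform. *)
Let K_small ph (e : R) : 0 < e ->
  \forall r \near (1:R)^'+, forall th, th \in `[0, pi] -> `|K ph r th| < e.
Proof.
move=> e0.
have /compact_near_coveringP cov := @segment_compact R 0 pi.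
have : \forall r \near (1:R)^'+, `[0, pi]%classic `<=` (fun th => `|K ph r th| < e).
  apply: (cov _ ((1:R)^'+) (fun r th => `|K ph r th| < e)).
  move=> th thpi; pose F := filter_prod (nbhs th) ((1:R)^'+).
  have c1 : z.1 @[z --> F] --> th by exact: cvg_fst.
  have c2 : z.2 @[z --> F] --> (1:R)^'+ by exact: cvg_snd.
  have c2' : z.2 @[z --> F] --> (1:R) by apply: cvg_trans c2 _; exact: cvg_within.
  have cw : sph z.2 z.1 ph @[z --> F] --> within (@ext1 R) (nbhs (sph 1 th ph)).
    exact: cvg_sph_ext.
  have KE : K ph z.2 z.1 @[z --> F] -->
     \sum_(i < 3) (\sum_(j < 3) H i j (sph 1 th ph) * sph_th 1 th ph 0 j)
       * sph 1 th ph 0 i.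
    apply: cvg_sum3 => i; apply: cvgM; last first.
      exact: (cvg_comp _ _ (cvg_sph c2' c1) (@coord_continuous _ _ _ 0 i _)).
    apply: cvg_sum3 => j; apply: cvgM; last exact: cvg_sph_th.
    exact: (cvg_comp _ _ cw (@H_cvg i j _ (sph1 th ph))).
  rewrite tangential_hessian in KE; last exact: tangential.
  have /cvgr0Pnorm_lt/(_ e e0) := KE.
  by [].
by apply: filterS => r h th thpi; exact: h.
Qed.

(** The trace of [psi] on the sphere: the difference [d_r Phi - Phi] there. *)
Let c w := \sum_(i < 3) G i w * w 0 i - Phi w.

Let Phi_trace w : sphere1 w -> Phi y @[y --> within (@ext1 R) (nbhs w)] --> Phi w.
Proof.
move=> w1 A wA; have /within_continuousP fc := Phi_within.
have h : \forall y \near w, (@ext1 R `|` @sphere1 R) y -> A (Phi y).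
  by apply: fc wA; right.
suff : \forall y \near w, ext1 y -> A (Phi y) by [].
by apply: filterS h => y hy y1; apply: hy; left.
Qed.

Let grad_radial_cvg w : sphere1 w ->
  \sum_(i < 3) partial i Phi (r *: w) * w 0 i @[r --> (1:R)^'+] --> c w + Phi w.
Proof.
move=> w1; rewrite /c subrK; have [th [ph [_ wE]]] := sph_surj w.
rewrite w1 in wE; rewrite wE; under eq_fun do rewrite sphZ mulr1.
apply: cvg_sum3 => i; apply: cvgM; last exact: cvg_cst.
exact: (cvg_comp _ _ (@r_cvg th ph) (@G_cvg i _ (sph1 th ph))).
Qed.

Let psi_cvg th ph : psi (sph r th ph) @[r --> (1:R)^'+] --> c (sph 1 th ph).
Proof.
have r1 : (r @[r --> (1:R)^'+] --> (1:R)) by exact: cvg_within.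
have hs i : sph r th ph 0 i @[r --> (1:R)^'+] --> sph 1 th ph 0 i.
  exact: (cvg_comp _ _ (cvg_sph r1 (cvg_cst th)) (@coord_continuous _ _ _ 0 i _)).
apply: cvgB.
  apply: cvg_sum3 => i; apply: cvgM; last exact: hs.
  exact: (cvg_comp _ _ (@r_cvg th ph) (@G_cvg i _ (sph1 th ph))).
exact: (cvg_comp _ _ (@r_cvg th ph) (Phi_trace (sph1 th ph))).
Qed.

Lemma sph_north r ph ph' : sph r 0 ph = sph r 0 ph' :> 'rV[R]_3.
Proof. by rewrite /sph sin0 !mulr0 !mul0r. Qed.

(** Integrate the derivative of [psi] along the meridian from the north pole,
    where [sph r 0 ph] is independent of [ph], slightly outside the sphere. *)
Let c_const w : sphere1 w -> c w = c (sph 1 0 0).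
Proof.
move=> w1; have [th [ph [thpi wE]]] := sph_surj w.
rewrite w1 in wE; rewrite wE (sph_north 1 0 ph).
apply/eqP; rewrite -subr_eq0 -normr_le0; apply/ler_addgt0Pr => e e0.
rewrite add0r.
have pi0 : (0:R) < pi := pi_gt0 R.
have ep : 0 < e / pi by rewrite divr_gt0.
have hc : (psi (sph r th ph) - psi (sph r 0 ph)) @[r --> (1:R)^'+] -->
    c (sph 1 th ph) - c (sph 1 0 ph) by apply: cvgB; exact: psi_cvg.
have hn : `|psi (sph r th ph) - psi (sph r 0 ph)| @[r --> (1:R)^'+] -->
    `|c (sph 1 th ph) - c (sph 1 0 ph)| by exact: cvg_norm.
apply: (cvgr_to_le hn).
near=> r.
have r1 : 1 < r by near: r; exact: nbhs_right_gt.
have Ks : forall th, th \in `[0, pi] -> `|K ph r th| < e / pi.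
  by near: r; exact: K_small.
have /andP[th0 thp] := thpi.
have [||t] := @MVT_segment R (fun s => psi (sph r s ph)) (K ph r) 0 th th0.
- by move=> s _; exact: psi_derive.
- apply: derivable_within_continuous => s _.
  by have [] := psi_derive s ph r1.
rewrite in_itv/= => /andP[t0 tth] ->; rewrite subr0 normrM (ger0_norm th0).
have Kt : `|K ph r t| < e / pi.
  by apply: Ks; rewrite in_itv/= t0 (le_trans tth).
apply: (@le_trans _ _ (e / pi * pi)); last by rewrite divfK// gt_eqF.
by apply: ler_pM => //; exact: ltW.
Unshelve. all: by end_near. Qed.

Hypothesis Phi_harm : forall y, ext1 y -> laplacian Phi y = 0.
Hypothesis Phi_decay : far_field_decay Phi.

(** The gradient is of size [r ^- 2], and any two points of the sphere of radius
    [r] are joined through the north pole by two arcs of length at most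
    [pi * r]. *)
Let Phi_osc (e : R) : 0 < e -> exists A : R, forall y z,
  A < enorm y -> enorm y = enorm z -> `|Phi y - Phi z| < e.
Proof.
move=> e0; have [[C [A hA]] _] := Phi_decay.
have pi0 : (0:R) < pi := pi_gt0 R.
pose B := 6 * pi * `|C| / e.
exists (Num.max 1 (Num.max A B)) => y z; rewrite !gt_max => /and3P[y1 yA yB] yz.
have n0 : 0 < enorm y by rewrite (lt_trans ltr01).
suff north w : enorm w = enorm y ->
    `|Phi w - Phi (sph (enorm y) 0 0)| < e / 2.
  have h1 := north y erefl; have h2 := north z (esym yz).
  rewrite -(subrKA (Phi (sph (enorm y) 0 0))) (le_lt_trans (ler_normD _ _))//.
  by rewrite [X in _ + X]distrC (splitr e) ltrD.
move=> wy; have [th [ph [/andP[th0 thp] wE]]] := sph_surj w.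
rewrite wy in wE; rewrite wE (sph_north _ 0 ph).
set r := enorm y in n0 y1 yA yB wE *.
pose d s := \sum_(i < 3) partial i Phi (sph r s ph) * sph_th r s ph 0 i.
have dP (s : R) : is_derive s 1 (fun s => Phi (sph r s ph)) (d s).
  apply: (@is_derive_curve R Phi (fun s => sph r s ph) (sph_th r s ph)).
    exact/D1/ext_sph.
  exact: is_derive_sph_th.
have [|t _ ->] := @MVT_segment R (fun s => Phi (sph r s ph)) d 0 th th0
    (fun s _ => dP s).
  by apply: derivable_within_continuous => s _; have [] := dP s.
have r0 : `|r| = r by rewrite gtr0_norm.
have b i : `|partial i Phi (sph r t ph) * sph_th r t ph 0 i| <= `|C| / r.
  have h1 : `|partial i Phi (sph r t ph)| <= `|C| * r ^- 2.
    have := hA (sph r t ph); rewrite enorm_sph r0 => /(_ yA) h.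
    have := coord_le_enorm (grad Phi (sph r t ph)) i; rewrite mxE => h'.
    apply: le_trans h' (le_trans h _); rewrite ler_wpM2r ?ler_norm//.
    by rewrite invr_ge0 exprn_ge0// ltW.
  have h2 : `|sph_th r t ph 0 i| <= r.
    have s1 := @sin_max R; have c1 := @cos_max R.
    elim/ord3P : i {h1}; rewrite /sph_th !mk3E !normrM ?normrN r0.
    - rewrite -mulrA ler_piMr ?(ltW n0)// mulr_ile1//.
    - rewrite -mulrA ler_piMr ?(ltW n0)// mulr_ile1//.
    - by rewrite ler_piMr ?(ltW n0).
  rewrite normrM; apply: le_trans (ler_pM _ _ h1 h2) _ => //.
  by rewrite expr2 invfM -!mulrA mulVf ?gt_eqF// mulr1.
have dt : `|d t| <= 3 * (`|C| / r).
  rewrite /d (le_trans (ler_norm_sum _ _ _))// sum3.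
  have := b 0; have := b 1; have := b 2%:R; lra.
rewrite normrM subr0 (ger0_norm th0).
apply: (@le_lt_trans _ _ (3 * (`|C| / r) * pi)).
  by apply: ler_pM.
have re : 6 * pi * `|C| < r * e by rewrite -ltr_pdivrMr.
rewrite (_ : 3 * (`|C| / r) * pi = (6 * pi * `|C|) / r / 2); last by field; rewrite gt_eqF.
by rewrite ltr_pM2r// ltr_pdivrMr// [e * r]mulrC.
Qed.

Section Reflection.
Variable Q : 'M[R]_3.
Hypothesis QQ : Q^T *m Q = 1%:M.

Let enormQ y : enorm (y *m Q) = enorm y.
Proof.
have e w : enorm w ^+ 2 = (w *m w^T) 0 0.
  by rewrite sqr_enorm mxE; apply: eq_bigr => i _; rewrite mxE expr2.
apply/eqP; rewrite -(@eqrXn2 _ 2)// ?enorm_ge0// !e.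
by rewrite trmx_mul mulmxA -[y *m Q *m _]mulmxA (mulmx1C QQ) mulmx1.
Qed.

Let Psi y := Phi y + -1 * Phi (y *m Q).

(** On the sphere [d_r Phi] equals [Phi] plus a constant, so [Psi] satisfies
    [d_r Psi = Psi] and increases outwards wherever it is positive. *)
Lemma reflection_le y : 1 <= enorm y -> Phi y <= Phi (y *m Q).
Proof.
move=> y1; suff : Psi y <= 0 by rewrite /Psi mulN1r subr_le0.
have cQ : {within @ext1 R `|` @sphere1 R, continuous (fun y => Phi (y *m Q))}.
  have DQ z : (@ext1 R `|` @sphere1 R) z -> (@ext1 R `|` @sphere1 R) (z *m Q).
    by rewrite ext_closureE/= enormQ.
  exact: (continuous_within_precomp DQ (@mulmx_continuous R Q) Phi_within).
have cPsi : {within @ext1 R `|` @sphere1 R, continuous Psi}.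
  have c2 : {within @ext1 R `|` @sphere1 R, continuous (fun y => -1 * Phi (y *m Q))}.
    by move=> z; apply: cvgM; [exact: cvg_cst|exact: cQ].
  by move=> z; apply: cvgD; [exact: Phi_within|exact: c2].
apply: (exterior_robin cPsi) y1.
- have h1 : harmonic_on (@ext1 R) Phi by apply: harmonic_onC2 => //; case: Phi_C2.
  have h2 : harmonic_on (@ext1 R) (fun y => Phi (y *m Q)).
    have h : harmonic_on [set y | ext1 (y *m Q)] (fun y => Phi (y *m Q)).
      by apply: harmonic_on_mulmx => //; case: Phi_C2.
    by apply: harmonic_onS h => z; rewrite /ext1/= enormQ.
  exact: harmonic_onD h1 (harmonic_onZ (-1) h2).
- move=> e /Phi_osc[A hA]; exists A => z Az.
  have := hA z (z *m Q) Az; rewrite enormQ => /(_ erefl).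
  by rewrite /Psi mulN1r; exact: le_lt_trans (ler_norm _).
- move=> w w1 Pw.
  have wQ1 : sphere1 (w *m Q) by rewrite /sphere1/= enormQ.
  pose d w r := \sum_(i < 3) partial i Phi (r *: w) * w 0 i.
  have dd : (d w r - d (w *m Q) r) @[r --> (1:R)^'+] --> Psi w.
    have -> : Psi w = (c w + Phi w) - (c (w *m Q) + Phi (w *m Q)).
      by rewrite (c_const w1) (c_const wQ1) /Psi; ring.
    by apply: cvgB; exact: grad_radial_cvg.
  have dpos : \forall r \near (1:R)^'+, 0 < d w r - d (w *m Q) r.
    exact: (cvgr_gt _ dd).
  have /nbhs_ballP[r0 /= r00 hr0] := dpos.
  near=> r.
  have r1 : 1 < r by near: r; exact: nbhs_right_gt.
  have rr : r < 1 + r0 by near: r; apply: nbhs_right_lt; rewrite ltrDl.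
  have ext z (s : R) : sphere1 z -> 1 < s -> ext1 (s *: z).
    by move=> z1 s1; rewrite /ext1/= enormZ z1 mulr1 gtr0_norm// (lt_trans ltr01).
  have dPhi z (s : R) : sphere1 z -> 1 < s ->
      is_derive s 1 (fun s => Phi (s *: z)) (d z s).
    move=> z1 s1; apply: (@is_derive_curve R Phi (fun s => s *: z) z).
      exact/D1/ext.
    move=> i; have -> : (fun s : R => (s *: z) 0 i) = (fun s => s * z 0 i).
      by apply/funext => t; rewrite mxE.
    by apply: is_derive_eq; rewrite /GRing.scale/=; ring.
  have dPsi (s : R) : 1 < s -> is_derive s 1 (fun s => Psi (s *: w)) (d w s - d (w *m Q) s).
    move=> s1; have -> : (fun s => Psi (s *: w)) =
        (fun s => Phi (s *: w)) - (fun s => Phi (s *: (w *m Q))).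
      by apply/funext => t; rewrite /Psi -scalemxAl mulN1r.
    by apply: is_deriveB; exact: dPhi.
  have [||t] := @MVT R (fun s => Psi (s *: w)) (fun s => d w s - d (w *m Q) s) 1 r r1.
  + by move=> s; rewrite in_itv/= => /andP[s1 _]; exact: dPsi.
  + have Dsw (s : R) : `[1, r]%classic s -> (@ext1 R `|` @sphere1 R) (s *: w).
      rewrite ext_closureE/= in_itv/= => /andP[s1 _].
      by rewrite enormZ w1 mulr1 gtr0_norm// (lt_le_trans ltr01).
    have sc : continuous (fun s : R => s *: w) by move=> s; exact: scalel_continuous.
    exact: (@continuous_within_precomp _ _ _ _ _ _ Psi Dsw sc cPsi).
  rewrite in_itv/= => /andP[t1 tr]; rewrite scale1r => E.
  rewrite -subr_ge0 E mulr_ge0 ?subr_ge0 ?(ltW r1)//.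
  have tb : ball (1:R) r0 t.
    by rewrite /ball/= distrC gtr0_norm ?subr_gt0// ltrBlDl (lt_trans tr).
  by rewrite -subr_ge0; apply: ltW; exact: (hr0 _ tb t1).
Unshelve. all: by end_near. Qed.

End Reflection.

(** The reflection in the plane orthogonal to [y - z]. *)
Lemma householder y z : enorm y = enorm z -> exists2 Q : 'M[R]_3,
  Q^T *m Q = 1%:M & y *m Q = z.
Proof.
move=> yz; have [->|ney] := eqVneq y z.
  by exists 1%:M; rewrite ?trmx1 ?mulmx1.
pose n := y - z; pose N := enorm n ^+ 2.
have N0 : N != 0 by rewrite expf_neq0// enorm_eq0 subr_eq0.
have dot (v w : 'rV[R]_3) : v *m w^T = (\sum_(i < 3) v 0 i * w 0 i)%:M.
  apply/matrixP => i j; rewrite !ord1 !mxE eqxx mulr1n.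
  by apply: eq_bigr => k _; rewrite mxE.
have nn : n *m n^T = N%:M.
  by rewrite dot /N sqr_enorm; congr (_%:M); apply: eq_bigr => i _; rewrite expr2.
have yn : y *m n^T = (N / 2)%:M.
  rewrite dot; congr (_%:M).
  have h1 := sqr_enorm y; have h2 := sqr_enorm z; move: h2; rewrite -yz h1.
  rewrite /N sqr_enorm !sum3 /n !mxE => h; lra.
pose Q : 'M[R]_3 := 1%:M - (2 / N) *: (n^T *m n).
have QT : Q^T = Q.
  by rewrite /Q linearB/= linearZ/= trmx1 trmx_mul trmxK.
exists Q.
  rewrite QT {1}/Q mulmxBl mul1mx -scalemxAl {2}/Q mulmxBr mulmx1 -scalemxAr.
  have -> : n^T *m n *m (n^T *m n) = N *: (n^T *m n).
    by rewrite mulmxA -[n^T *m n *m _]mulmxA nn mul_mx_scalar scalemxAl.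
  rewrite /Q; move: (n^T *m n) => M; apply/matrixP => i j; rewrite !mxE.
  by field.
rewrite /Q mulmxBr mulmx1 -scalemxAr mulmxA yn mul_scalar_mx scalerA.
rewrite (_ : 2 / N * (N / 2) = 1) ?scale1r; last by field.
by rewrite /n opprB addrC subrK.
Qed.

(** [reflection_le] for a reflection that maps [y] to [z], and conversely. *)
Lemma exterior_radial y z : 1 <= enorm y -> enorm y = enorm z -> Phi y = Phi z.
Proof.
move=> y1 yz.
have [Q QQ yQ] := householder yz; have [Q' QQ' zQ] := householder (esym yz).
apply/eqP; rewrite eq_le; apply/andP; split.
  by rewrite -yQ; exact: reflection_le.
by rewrite -zQ; apply: reflection_le; rewrite -?yz.
Qed.

End Exterior.

(** * Radial symmetry of the solution *)

Section Radial.
Context {R : realType}.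

Lemma near_derive1 (f g : R -> R) (t : R) : (\near t, f t = g t) ->
  derive1 f t = derive1 g t.
Proof. by move=> fg; rewrite !derive1E; exact: near_eq_derive. Qed.

Lemma lim_near_eq (F : set_system R) {FF : Filter F} (f g : R -> R) :
  (\forall r \near F, f r = g r) -> lim (f @ F) = lim (g @ F).
Proof.
move=> fg; suff -> : f @ F = g @ F by [].
by apply/seteqP; split => A; rewrite !nbhs_simpl/=; apply: filterS2 fg => r /= ->.
Qed.

(** Derivatives at [r > 1] only see values outside the ball, where [Phi] is
    radial. *)
Lemma bv_ext_radial2 (Phi : 'rV[R]_3 -> R) :
  (forall y z, 1 <= enorm y -> enorm y = enorm z -> Phi y = Phi z) ->
  forall th ph th' ph',
    bv_ext (d_r (d_r (in_sph Phi))) th ph = bv_ext (d_r (d_r (in_sph Phi))) th' ph'.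
Proof.
move=> Pr th ph th' ph'.
have gt1 (r : R) : 1 < r -> \forall s \near r, 1 < s by exact: lt_nbhsr.
have e0 s : 1 < s -> in_sph Phi s th ph = in_sph Phi s th' ph'.
  by move=> s1; apply: Pr; rewrite !enorm_sph// ltW// gtr0_norm// (lt_trans ltr01).
have e1 s : 1 < s -> d_r (in_sph Phi) s th ph = d_r (in_sph Phi) s th' ph'.
  by move=> /gt1 H; apply: near_derive1; apply: filterS H => x; exact: e0.
have e2 s : 1 < s -> d_r (d_r (in_sph Phi)) s th ph = d_r (d_r (in_sph Phi)) s th' ph'.
  by move=> /gt1 H; apply: near_derive1; apply: filterS H => x; exact: e1.
apply: lim_near_eq; have := nbhs_right_gt (1 : R).
by apply: filterS => s; exact: e2.
Qed.

Lemma within_radial_cvg (f : 'rV[R]_3 -> R) w :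
  {within @ext1 R `|` @sphere1 R, continuous f} -> sphere1 w ->
  f (s *: w) @[s --> (1:R)^'+] --> f w.
Proof.
move=> /within_continuousP fc w1.
have [th [ph [_ wE]]] := sph_surj w; rewrite w1 in wE.
rewrite wE; under eq_fun do rewrite sphZ mulr1.
have r_cvg : sph r th ph @[r --> (1 : R)^'+] --> within (@ext1 R) (nbhs (sph 1 th ph)).
  by apply: cvg_sph_ext; [exact: cvg_id|exact: cvg_cst].
move=> A hA.
have h : \forall y \near sph 1 th ph, (@ext1 R `|` @sphere1 R) y -> A (f y).
  by apply: fc hA; right; rewrite /sphere1/= enorm_sph normr1.
have h' : \forall y \near sph 1 th ph, ext1 y -> A (f y).
  by apply: filterS h => y hy y1; apply: hy; left.
exact: (r_cvg (fun y => A (f y)) h').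
Qed.

Lemma cvg_up_to_0 (D : set 'rV[R]_3) (f : 'rV[R]_3 -> R -> R) y :
  continuous_up_to_0 D f -> D y -> f y s @[s --> (0:R)^'+] --> f y 0.
Proof.
move=> /within_continuousP fc Dy A hA.
have h : \forall z \near (y, 0 : R), D z.1 /\ 0 <= z.2 -> A (f z.1 z.2).
  by apply: (fc (y, 0) _ A hA); split.
have c : (y, s) @[s --> (0:R)] --> (y, 0 : R).
  exact: (cvg_pair (cvg_cst y) cvg_id).
have h' : \forall s \near (0:R), D y /\ 0 <= s -> A (f y s) := c _ h.
suff : \forall s \near (0:R), 0 < s -> A (f y s) by [].
by apply: filterS h' => s hs s0; apply: hs; split => //; exact: ltW.
Qed.

Lemma eq_up_to_0 (D : set 'rV[R]_3) (f : 'rV[R]_3 -> R -> R) y z :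
  continuous_up_to_0 D f -> D y -> D z ->
  (forall t, 0 < t -> f y t = f z t) -> forall t, 0 <= t -> f y t = f z t.
Proof.
move=> fc Dy Dz fyz t; rewrite le_eqVlt => /orP[/eqP <-|]; last exact: fyz.
have h1 := cvg_up_to_0 fc Dy; have h2 := cvg_up_to_0 fc Dz.
suff h3 : f y s @[s --> (0:R)^'+] --> f z 0 by apply: (cvg_unique _ h1 h3).
apply: cvg_trans h2; apply: near_eq_cvg.
by near=> s; rewrite fyz//; near: s; exact: nbhs_right_gt.
Unshelve. all: by end_near. Qed.

End Radial.

Unset Implicit Arguments.
Set Strict Implicit.

Theorem theorem4p2 (R : realType) (c : params R)
    (calR Phil varrho Pl Phig : 'rV[R]_3 -> R -> R) (Pg : R -> R)
    (hc : admissible c)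
    (hmu : 0 < mu_l c)
    (hX : C1_curve_X c (snapshot calR Phil varrho))
    (hreg : classical_regularity calR Phil varrho Pl Phig Pg)
    (hsys : viscous_system c calR Phil varrho Pl Phig Pg) :
  (exists phi : R -> R -> R, forall (t : R) (y : 'rV[R]_3),
     0 <= t -> 1 <= enorm y -> Phil y t = phi (enorm y) t) /\
  (exists rad : R -> R, forall (t : R) (w : 'rV[R]_3),
     0 <= t -> enorm w = 1 -> calR w t = rad t).
Proof.
have Phi_rad (t : R) y z : 0 < t -> 1 <= enorm y -> enorm y = enorm z ->
    Phil y t = Phil z t.
  move=> t0; apply: (@exterior_radial R (Phil ^~ t)).
  - exact: (reg_Phil hreg).
  - by move=> th ph thpi; exact: (sys_tangential_th hsys).
  - by move=> x x1; exact: (sys_liq_harmonic hsys).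
  - by have [] := sys_far_field hsys t0.
pose e : 'rV[R]_3 := sph 1 0 0.
have ne (r : R) : 0 <= r -> enorm (r *: e) = r.
  by move=> r0; rewrite sphZ enorm_sph mulr1 ger0_norm.
have Pl_ext (t : R) y z : 0 < t -> ext1 y -> enorm y = enorm z -> Pl y t = Pl z t.
  move=> t0 y1 yz; have z1 : ext1 z by rewrite /ext1/= -yz.
  have b0 : - (rho_l c * R_star c)^-1 != 0.
    rewrite oppr_eq0 invr_eq0 mulf_neq0// gt_eqF//.
      exact: adm_rho_l hc.
    exact: adm_R_star hc.
  (* Bernoulli's equation expresses the pressure by the time derivative of a
     potential that is radial at all nearby times. *)
  apply: (mulfI b0); rewrite -!(sys_bernoulli hsys)//.
  apply: near_derive1.
  have : \forall s \near t, 0 < s by exact: lt_nbhsr.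
  by apply: filterS => s s0; apply: Phi_rad => //; exact: ltW.
have Pl_sphere (t : R) w w' : 0 < t -> sphere1 w -> sphere1 w' -> Pl w t = Pl w' t.
  move=> t0 w1 w1'.
  have h1 := within_radial_cvg (reg_Pl hreg t0) w1.
  have h2 := within_radial_cvg (reg_Pl hreg t0) w1'.
  suff h3 : Pl (s *: w) t @[s --> (1:R)^'+] --> Pl w' t.
    exact: (cvg_unique _ h1 h3).
  apply: cvg_trans h2; apply: near_eq_cvg; near=> s.
  have s1 : 1 < s by near: s; exact: nbhs_right_gt.
  have s0 : 0 <= s by rewrite ltW// (lt_trans ltr01).
  apply: Pl_ext => //; first by rewrite /ext1/= enormZ w1' mulr1 ger0_norm.
  by rewrite !enormZ w1 w1'.
have calR_rad (t : R) w w' : 0 < t -> sphere1 w -> sphere1 w' -> calR w t = calR w' t.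
  move=> t0.
  pose k := - (R_star c ^+ 2 / sigma c) * (Pg t - Pl e t +
     2 * mu_l c / R_star c ^+ 2 * bv_ext (d_r (d_r (in_sph (Phil ^~ t)))) 0 0).
  have s0 : sigma c != 0 by rewrite gt_eqF//; exact: adm_sigma hc.
  have R0 : R_star c != 0 by rewrite gt_eqF//; exact: adm_R_star hc.
  have eigen (th ph : R) : 0 < th < pi -> 2 * calR (sph 1 th ph) t +
      laplace_beltrami (calR ^~ t) th ph = k.
    move=> thpi; have := @sys_normal_stress _ _ _ _ _ _ _ _ hsys t th ph t0 thpi.
    have -> : Pl (sph 1 th ph) t = Pl e t.
      by apply: Pl_sphere => //; rewrite /sphere1/= enorm_sph normr1.
    rewrite (@bv_ext_radial2 R (Phil ^~ t) (fun y z => Phi_rad t y z t0) th ph 0 0).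
    by rewrite /k => ->; field; rewrite R0.
  have [a ha] := laplace_beltrami_eigen2 (reg_calR hreg t0) eigen.
  have a0 := centroid_linear_eq0 ha
    (fun m hm => sys_centroid hsys (ltW t0) hm).
  by move=> w1 w1'; rewrite (ha w)// (ha w')// !big1// => i _; rewrite a0 mulr0.
split.
  exists (fun r t => Phil (r *: e) t) => t y t0 y1.
  have y0 : 0 <= enorm y by exact: enorm_ge0.
  have D z : 1 <= enorm z -> (@ext1 R `|` @sphere1 R) z by rewrite ext_closureE.
  apply: (eq_up_to_0 (reg_Phil0 hreg)) t0 => //.
  - exact: D.
  - by apply: D; rewrite ne.
  - by move=> s s0; apply: Phi_rad; rewrite ?ne.
exists (fun t => calR e t) => t w t0 w1.
have e1 : sphere1 e by rewrite /sphere1/= enorm_sph normr1.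
by apply: (eq_up_to_0 (reg_calR0 hreg)) t0 => // s s0; exact: calR_rad.
Unshelve. all: by end_near. Qed.
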